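(* For any vector of reported privacy sensitivities $(c_1,\dots,c_n)$, Algorithm 1 (given in full in the context) finds the optimal privacy loss levels in the optimal central data acquisition mechanism, i.e. the solution $(y_1^*,\dots,y_n^* )$ of the problem $$\min_{\mathbf y}\ \frac{n+1}{\left(\sum_{j=1}^n y_j\right)^2}\Big(2+\sum_{i=1}^n y_i^2\,\mathrm{VAR}\Big)+\sum_{i=1}^n\psi_i(c_i)\,y_i\qquad\text{s.t. } y_i\ge0\ \text{ for all } i\in\{1,\dots,n\},$$ in time $\mathcal O(n\log n)$.
   Context: $\mathrm{VAR}$ is the variance of each user's data, $c_i\in\mathbb R_+$ (nonnegative reals) is the privacy sensitivity reported by user $i$, and $\psi_i(c)=c+\frac{F_i(c)}{f_i(c)}$ is the virtual cost of user $i$, where $F_i$ and $f_i$ are the CDF and density of user $i$'s privacy sensitivity. Algorithm 1. Input: the vector $(c_1,\dots,c_n)$. 1. Sort the terms $\psi_i(c_i)$; without loss of generality assume $\psi_1(c_1)\le\dots\le\psi_n(c_n)$, with the convention $\psi_{n+1}(c_{n+1})=\infty$. Let $B_0=\tilde B_0=0$. 2. For $i=1$ to $n$: let $$A_i=\frac{i}{2(n+1)\mathrm{VAR}},\qquad B_i=B_{i-1}+\frac{\psi_i(c_i)}{2(n+1)\mathrm{VAR}},\qquad \tilde B_i=\tilde B_{i-1}+\frac{\psi_i(c_i)^2}{2(n+1)\mathrm{VAR}},$$ $$OBJ_i(\lambda)=2(n+1)\left(\lambda A_i-B_i\right)^2+\frac{A_i\lambda^2-\tilde B_i}{2\left(\lambda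 A_i-B_i\right)^2},$$ and let $\lambda_i^*=\arg\min_\lambda OBJ_i(\lambda)$ subject to $\psi_i(c_i)\le\lambda\le\psi_{i+1}(c_{i+1})$. 3. Let $i^*=\arg\min_i OBJ_i(\lambda_i^* )$. 4. Output: $y_j^*=0$ for $j>i^*$, and $y_j^*=\dfrac{\lambda^*_{i^*}-\psi_j(c_j)}{2(n+1)\mathrm{VAR}\left(\lambda^*_{i^*}A_{i^*}-B_{i^*}\right)^2}$ for $j\le i^*$.
   Formalization: If some reported sensitivity is 0 the problem may have no solution (n=1, virtual cost 0: infimum not attained); optimality is claimed whenever a solution exists, proved to be so when all c_i>0. Densities are assumed positive at the reports, so that virtual costs are defined. *)

(* Defs.v *)
(* MathComp-Analysis, over an arbitrary R : realType. *)
From HB Require Import structures.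
From mathcomp Require Import all_boot all_order all_algebra all_fingroup.
From mathcomp Require Import all_classical all_reals all_analysis.

Set Implicit Arguments.
Unset Strict Implicit.
Unset Printing Implicit Defensive.

Import Order.TTheory GRing.Theory Num.Theory.
Import numFieldNormedType.Exports.

Local Open Scope classical_set_scope.
Local Open Scope ring_scope.

Section Model.
Context (R : realType).

Definition is_density d (T : measurableType d) (P : probability T R)
    (X : {RV P >-> R}) (f : R -> R) : Prop :=
  [/\ measurable_fun setT f, (forall x, 0 <= f x)
    & forall U : set R, measurable U ->
        distribution P X U = (\int[lebesgue_measure]_(x in U) (f x)%:E)%E].

Definition virtual_cost (F f : R -> R) (c : R) : R := c + F c / f c.

(* The objective divides by (\sum_j y_j)^2; it is +oo where that sum is 0. *)
Definition acquisition_cost n (V : R) (psi y : 'I_n -> R) : \bar R :=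
  let S := \sum_j y j in
  if S == 0 then +oo%E
  else (n.+1%:R / S ^+ 2 * (2 + \sum_i y i ^+ 2 * V)
        + \sum_i psi i * y i)%:E.

Definition is_argmin (T : Type) (D : set T) (g : T -> \bar R) (x : T) : Prop :=
  D x /\ forall z, D z -> (g x <= g z)%E.

Definition optimal_levels n (V : R) (psi y : 'I_n -> R) : Prop :=
  is_argmin [set z : 'I_n -> R | forall i, 0 <= z i]
    (acquisition_cost V psi) y.

End Model.

(* Below, t i (1 <= i <= n) is the i-th smallest virtual cost. *)
Section Algorithm1.
Context (R : realType) (n : nat) (V : R) (t : nat -> R).

Definition coefM : R := 2 * n.+1%:R * V.

Definition coefA (i : nat) : R := i%:R / coefM.

Fixpoint coefB (i : nat) : R :=
  if i is k.+1 then coefB k + t k.+1 / coefM else 0.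

Fixpoint coefBt (i : nat) : R :=
  if i is k.+1 then coefBt k + t k.+1 ^+ 2 / coefM else 0.

(* lambda A_i - B_i = 0 corresponds to levels with an infinite sum; the value
   is +oo there. *)
Definition OBJ (i : nat) (l : R) : \bar R :=
  let u := l * coefA i - coefB i in
  if u == 0 then +oo%E
  else (2 * n.+1%:R * u ^+ 2
        + (coefA i * l ^+ 2 - coefBt i) / (2 * u ^+ 2))%:E.

(* t n.+1 plays the role of +oo. *)
Definition bracket (i : nat) : set R :=
  [set l | t i <= l /\ ((i < n)%N -> l <= t i.+1)].

Definition is_lambda (i : nat) (l : R) : Prop := is_argmin (bracket i) (OBJ i) l.

End Algorithm1.

Definition sorted_costs (R : realType) n (psi : 'I_n -> R) (s : 'S_n)
    (k : nat) : R :=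
  nth 0 [seq psi (s j) | j <- enum 'I_n] k.-1.

(* y is a possible output of the algorithm, whatever the way ties are broken
   in the sort and in the two argmins. An index i for which the infimum of
   OBJ i over its bracket is not attained (this happens only if t i = 0) does
   not compete for istar. *)
Definition algorithm1_returns (R : realType) n (V : R) (psi y : 'I_n -> R)
    : Prop :=
  exists (s : 'S_n) (lam : nat -> R) (istar : nat),
    let t := sorted_costs psi s in
    [/\ (forall j k : 'I_n, (j <= k)%N -> psi (s j) <= psi (s k)),
        (forall i, (1 <= i <= n)%N -> (exists l, is_lambda n V t i l) ->
           is_lambda n V t i (lam i)),
        is_argmin [set i | (1 <= i <= n)%N /\ is_lambda n V t i (lam i)]
          (fun i => OBJ n V t i (lam i)) istar
      & forall j : 'I_n, y (s j) =
          if (j.+1 <= istar)%N then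
            (lam istar - t j.+1)
            / (coefM n V * (lam istar * coefA n V istar - coefB n V t istar) ^+ 2)
          else 0].

(* Real RAM. Programs are polymorphic in the type K of reals, so that reals can
   be handled only through the instructions, each of which costs one time unit:
   small constants, arithmetic, square and cube roots, comparisons and queries
   to the cdf and to the density of a user (labels in I). Tick is one unit of
   control flow. Every recursive call below performs an instruction. *)
Variant binop := Add | Sub | Mul | Div.

Inductive prog (I K A : Type) : Type :=
| Ret of A
| Tick of prog I K A
| Const of nat & (K -> prog I K A)
| Arith of binop & K & K & (K -> prog I K A)
| Sqrt of K & (K -> prog I K A)
| Cbrt of K & (K -> prog I K A)
| Cdf of I & K & (K -> prog I K A)
| Pdf of I & K & (K -> prog I K A)
| Leq of K & K & (bool -> prog I K A).
Arguments Ret {I K A}.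

Fixpoint bind I K A A' (p : prog I K A) (q : A -> prog I K A') : prog I K A' :=
  match p with
  | Ret a => q a
  | Tick p' => Tick (bind p' q)
  | Const m k => Const m (fun x => bind (k x) q)
  | Arith o x y k => Arith o x y (fun z => bind (k z) q)
  | Sqrt x k => Sqrt x (fun z => bind (k z) q)
  | Cbrt x k => Cbrt x (fun z => bind (k z) q)
  | Cdf i x k => Cdf i x (fun z => bind (k z) q)
  | Pdf i x k => Pdf i x (fun z => bind (k z) q)
  | Leq x y k => Leq x y (fun b => bind (k b) q)
  end.

Notation "'let*' x ':=' p 'in' q" := (bind p (fun x => q))
  (at level 200, x name, p at level 100, q at level 200).

(* Result and running time. *)
Section Exec.
Context (R : realType) (I A : Type) (F f : I -> R -> R).

Definition pay (r : A * nat) : A * nat := (r.1, r.2.+1).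

Definition arith (o : binop) (x y : R) : R :=
  match o with
  | Add => x + y | Sub => x - y | Mul => x * y | Div => x / y
  end.

Fixpoint exec (p : prog I R A) : A * nat :=
  match p with
  | Ret a => (a, 0%N)
  | Tick p' => pay (exec p')
  | Const m k => pay (exec (k m%:R))
  | Arith o x y k => pay (exec (k (arith o x y)))
  | Sqrt x k => pay (exec (k (Num.sqrt x)))
  | Cbrt x k => pay (exec (k (x `^ 3^-1)))
  | Cdf i x k => pay (exec (k (F i x)))
  | Pdf i x k => pay (exec (k (f i x)))
  | Leq x y k => pay (exec (k (x <= y)))
  end.

End Exec.

Section Program.
Context (I K : Type).
Local Notation prog := (prog I K).
Local Notation user := (I * K)%type.

Definition tick : prog unit := Tick (Ret tt).
Definition constK m : prog K := Const m Ret.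
Definition addK x y : prog K := Arith Add x y Ret.
Definition subK x y : prog K := Arith Sub x y Ret.
Definition mulK x y : prog K := Arith Mul x y Ret.
Definition divK x y : prog K := Arith Div x y Ret.
Definition sqrtK x : prog K := Sqrt x Ret.
Definition cbrtK x : prog K := Cbrt x Ret.
Definition leqK x y : prog bool := Leq x y Ret.

Fixpoint virtual_costs (s : seq user) : prog (seq user) :=
  if s is (i, c) :: s' then
    let* a := Cdf i c Ret in
    let* b := Pdf i c Ret in
    let* q := divK a b in
    let* v := addK c q in
    let* r := virtual_costs s' in
    Ret ((i, v) :: r)
  else let* _ := tick in Ret [::].

(* Merge sort, with the same control structure as path.sort. *)
Fixpoint merge_costs (s1 : seq user) : seq user -> prog (seq user) :=
  if s1 is x1 :: s1' then
    fix merge_s1 (s2 : seq user) : prog (seq user) :=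
      if s2 is x2 :: s2' then
        let* b := leqK x1.2 x2.2 in
        if b then let* r := merge_costs s1' s2 in Ret (x1 :: r)
        else let* r := merge_s1 s2' in Ret (x2 :: r)
      else let* _ := tick in Ret s1
  else fun s2 => let* _ := tick in Ret s2.

Fixpoint sort_push (s1 : seq user) (ss : seq (seq user))
    : prog (seq (seq user)) :=
  match ss with
  | [::] => let* _ := tick in Ret [:: s1]
  | [::] :: ss' => let* _ := tick in Ret (s1 :: ss')
  | s2 :: ss' =>
      let* _ := tick in
      let* s := merge_costs s2 s1 in
      let* r := sort_push s ss' in
      Ret ([::] :: r)
  end.

Fixpoint sort_pop (s1 : seq user) (ss : seq (seq user)) : prog (seq user) :=
  if ss is s2 :: ss' then
    let* _ := tick in
    let* s := merge_costs s2 s1 in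
    sort_pop s ss'
  else let* _ := tick in Ret s1.

Fixpoint sort_rec (ss : seq (seq user)) (s : seq user) : prog (seq user) :=
  if s is x :: s' then
    let* _ := tick in
    let* r := sort_push [:: x] ss in
    sort_rec r s'
  else sort_pop [::] ss.

Fixpoint size_succ (s : seq user) : prog K :=
  if s is _ :: s' then
    let* m := size_succ s' in
    let* o := constK 1 in
    addK m o
  else constK 1.

Record candidate := Candidate {
  cand_point : K; cand_slope : K; cand_value : K }.

Definition better (p q : option candidate) : prog (option candidate) :=
  match p, q with
  | Some a, Some b =>
      let* c := leqK (cand_value a) (cand_value b) in Ret (if c then p else q)
  | None, _ => Ret q
  | _, None => Ret p
  end.

(* N is n + 1 and (A, B, Bt) the coefficients of the current index. *)
Definition consider (N A B Bt l : K) : prog (option candidate) :=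
  let* lA := mulK l A in
  let* u := subK lA B in
  let* z := constK 0 in
  let* b := leqK u z in
  if b then Ret None else
  let* u2 := mulK u u in
  let* Nu2 := mulK N u2 in
  let* two := constK 2 in
  let* x := mulK two Nu2 in
  let* l2 := mulK l l in
  let* Al2 := mulK A l2 in
  let* a := subK Al2 Bt in
  let* d := mulK two u2 in
  let* q := divK a d in
  let* v := addK x q in
  Ret (Some (Candidate l u v)).

(* With u = lambda A - B, the derivative of the objective vanishes iff
     u^4 - p u + q = 0,  p = B / (4 N A),  q = (A Bt - B^2) / (4 N A).
   The relevant root is the largest one, given by Ferrari's formula: with m the
   root of m^3 - q m - p^2 / 8 = 0 and w = sqrt (2 m), it is
     u = (w + sqrt (2 p / w - 2 m)) / 2.
   There is no real root if the discriminant (p^2/16)^2 - (q/3)^3 is negative. *)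
Definition stationary (N A B Bt : K) : prog (option K) :=
  let* zero := constK 0 in
  let* two := constK 2 in
  let* four := constK 4 in
  let* NA := mulK N A in
  let* e := mulK four NA in
  let* p := divK B e in
  let* ABt := mulK A Bt in
  let* B2 := mulK B B in
  let* a := subK ABt B2 in
  let* q := divK a e in
  let* p2 := mulK p p in
  let* c16 := constK 16 in
  let* h := divK p2 c16 in
  let* h2 := mulK h h in
  let* three := constK 3 in
  let* q1 := divK q three in
  let* q2 := mulK q1 q1 in
  let* q3 := mulK q2 q1 in
  let* disc := subK h2 q3 in
  let* b := leqK zero disc in
  if ~~ b then Ret None else
  let* s := sqrtK disc in
  let* h_plus := addK h s in
  let* h_minus := subK h s in
  let* r_plus := cbrtK h_plus in
  let* r_minus := cbrtK h_minus in
  let* m := addK r_plus r_minus in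
  let* m2 := mulK two m in
  let* w := sqrtK m2 in
  let* p' := mulK two p in
  let* p'' := divK p' w in
  let* g := subK p'' m2 in
  let* g' := sqrtK g in
  let* w' := addK w g' in
  let* u := divK w' two in
  let* uB := addK u B in
  let* l := divK uB A in
  Ret (Some l).

(* Minimiser of the objective over [lo, hi] (over [lo, +oo[ if hi is None): the
   best of the end points and of the stationary point, if it is in the range.
   If B = 0, the costs seen so far all vanish and the objective is increasing
   in lambda > 0: its infimum, at lambda = 0, is not attained. *)
Definition solve_bracket (N A B Bt lo : K) (hi : option K)
    : prog (option candidate) :=
  let* zero := constK 0 in
  let* b := leqK B zero in
  if b then Ret None else
  let* c1 := consider N A B Bt lo in
  let* c2 := if hi is Some r then consider N A B Bt r else Ret None in
  let* c12 := better c1 c2 in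
  let* st := stationary N A B Bt in
  if st is Some l then
    let* b1 := leqK lo l in
    let* b2 := if hi is Some r then leqK l r else Ret true in
    if b1 && b2 then
      let* c3 := consider N A B Bt l in
      better c12 c3
    else Ret c12
  else Ret c12.

(* State of the pass over the sorted costs: number i of costs read (kr as a
   real), coefficients B and Bt, and the best candidate so far with its index. *)
Record scan_state := ScanState {
  kr : K; accB : K; accBt : K; idx : nat; best : option (candidate * nat) }.

Definition update_best (i : nat) (b : option (candidate * nat))
    (c : option candidate) : prog (option (candidate * nat)) :=
  match b, c with
  | _, None => Ret b
  | None, Some d => Ret (Some (d, i))
  | Some (d0, _), Some d =>
      let* le := leqK (cand_value d0) (cand_value d) in
      Ret (if le then b else Some (d, i))
  end.

(* M = 2 (n + 1) V; x is the cost being read and hi the next one, if any. *)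
Definition scan_step (N M : K) (st : scan_state) (x : K) (hi : option K)
    : prog scan_state :=
  let* one := constK 1 in
  let* k := addK (kr st) one in
  let* A := divK k M in
  let* xM := divK x M in
  let* B := addK (accB st) xM in
  let* x2 := mulK x x in
  let* x2M := divK x2 M in
  let* Bt := addK (accBt st) x2M in
  let* c := solve_bracket N A B Bt x hi in
  let* b := update_best (idx st).+1 (best st) c in
  Ret (ScanState k B Bt (idx st).+1 b).

Fixpoint scan (N M : K) (st : scan_state) (s : seq user) : prog scan_state :=
  if s is (_, x) :: s' then
    let* st' := scan_step N M st x (omap snd (ohead s')) in
    scan N M st' s'
  else let* _ := tick in Ret st.

Fixpoint levels (lam den zero : K) (istar : nat) (s : seq user)
    : prog (seq user) :=
  if s is (a, x) :: s' then
    if istar is i.+1 then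
      let* d := subK lam x in
      let* y := divK d den in
      let* r := levels lam den zero i s' in
      Ret ((a, y) :: r)
    else
      let* _ := tick in
      let* r := levels lam den zero 0 s' in
      Ret ((a, zero) :: r)
  else let* _ := tick in Ret [::].

(* The output lists the pairs (user, level); it is None if no index has a
   minimiser. *)
Definition algorithm1 (V : K) (reports : seq user) : prog (option (seq user)) :=
  let* t := virtual_costs reports in
  let* s := sort_rec [::] t in
  let* N := size_succ s in
  let* two := constK 2 in
  let* NV := mulK N V in
  let* M := mulK two NV in
  let* zero := constK 0 in
  let* st := scan N M (ScanState zero zero zero 0 None) s in
  if best st is Some (c, istar) then
    let* u2 := mulK (cand_slope c) (cand_slope c) in
    let* den := mulK M u2 in
    let* out := levels (cand_point c) den zero istar s in
    Ret (Some out)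
  else Ret None.

End Program.

Definition reports (R : realType) n (c : 'I_n -> R) : seq ('I_n * R) :=
  [seq (i, c i) | i <- enum 'I_n].

(* Main.v *)
Require Import Defs.
From HB Require Import structures.
From mathcomp Require Import all_boot all_order all_algebra all_fingroup.
From mathcomp Require Import all_classical all_reals all_analysis.
From mathcomp Require Import ring lra zify.
Import Order.TTheory GRing.Theory Num.Theory.
Import numFieldNormedType.Exports.
Local Open Scope classical_set_scope.
Local Open Scope ring_scope.

(* For a prescribed total S = 1 / u the objective is a convex quadratic, minimised by
   water filling: y_j is proportional to (lambda - psi_j)^+, where lambda is such that
   lambda A_i - B_i = u on the bracket containing lambda. The value is then OBJ_i(lambda),
   so the problem reduces to minimising each OBJ_i over its bracket. In terms of u, the
   sign of the derivative of OBJ_i is that of a quartic u^4 - p u + q with at most two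
   positive roots. Hence the minimum is at an end of the bracket or at the largest root,
   which Ferrari's formula computes. The running time is dominated by the merge sort: an
   element takes part in at most log_2 n + 1 merges while the stack is being filled. *)

Set Implicit Arguments.
Unset Strict Implicit.
Unset Printing Implicit Defensive.

(** * Levels with a prescribed total *)

(** Neither derivatives nor compactness are used. An exact formula for the difference of the cost at
    two slopes turns a comparison of values into a sign of the quartic. Each competitor in a bracket
    is then beaten individually by an end or by the root, and the existence of a minimiser comes out
    of running the program. The delicate points are the degenerate ones. By Cauchy-Schwarz on the
    first i costs, q >= 0, which keeps all the radicals in Ferrari's formula real. If these costs
    are all equal, the slope vanishes at the left end of the bracket and OBJ is +oo there; this is
    the equality case q = 0, so the end can be treated as a point of infinite cost. If they are all
    0, then B_i = 0 and the infimum over the bracket need not be attained. The program skips such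
    indices, and nothing is lost: when the problem is solvable, the minimum lies at an index with
    B_i > 0. *)

Section Levels.
Context (R : realType) (n : nat) (V : R) (t : nat -> R).
Hypothesis V0 : 0 < V.

Local Notation N := (n.+1%:R : R).
Local Notation M := (Defs.coefM n V).
Local Notation A := (Defs.coefA n V).
Local Notation B := (Defs.coefB n V t).
Local Notation Bt := (coefBt n V t).
Local Notation slope i l := (l * A i - B i).

Definition level (i : nat) (l : R) (j : nat) : R :=
  if (j < i)%N then (l - t j.+1) / (M * slope i l ^+ 2) else 0.

Lemma coefM_gt0 : 0 < M.
Proof. by rewrite /Defs.coefM !mulr_gt0 ?ltr0n. Qed.

Lemma coefBE i : B i = (\sum_(j < i) t j.+1) / M.
Proof.
elim: i => [|i IH] /=; first by rewrite big_ord0 mul0r.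
by rewrite IH big_ord_recr /= mulrDl.
Qed.

Lemma coefBtE i : Bt i = (\sum_(j < i) t j.+1 ^+ 2) / M.
Proof.
elim: i => [|i IH] /=; first by rewrite big_ord0 mul0r.
by rewrite IH big_ord_recr /= mulrDl.
Qed.

Lemma slopeE i l : slope i l = (\sum_(j < i) (l - t j.+1)) / M.
Proof.
rewrite coefBE /Defs.coefA sumrB sumr_const card_ord -mulr_natl mulrBl; ring.
Qed.

Lemma sum_prefix i (a : nat -> R) : (i <= n)%N ->
  \sum_(j < n) (if (j < i)%N then a j else 0) = \sum_(j < i) a j.
Proof. by move=> le_in; rewrite -big_mkcond -(big_ord_widen _ a le_in). Qed.

Lemma sum_level i l : (i <= n)%N -> slope i l != 0 ->
  \sum_(j < n) level i l j = (slope i l)^-1.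
Proof.
move=> le_in u0.
rewrite (sum_prefix (fun j => (l - t j.+1) / (M * slope i l ^+ 2))) //.
rewrite -mulr_suml invfM mulrA -slopeE expr2 invfM.
by rewrite mulrA divff // mul1r.
Qed.

Lemma cost_level i l : (i <= n)%N -> slope i l != 0 ->
  acquisition_cost V (fun j : 'I_n => t j.+1) (fun j => level i l j) =
  OBJ n V t i l.
Proof.
move=> le_in u0; rewrite /acquisition_cost /OBJ sum_level // invr_eq0.
rewrite (negbTE u0); congr EFin.
have M0 := lt0r_neq0 coefM_gt0.
set u := slope i l in u0 *.
have -> : \sum_(j < n) level i l j ^+ 2 * V
        = V * (\sum_(j < i) (l - t j.+1) ^+ 2) / (M * u ^+ 2) ^+ 2.
  rewrite -(sum_prefix (fun j => (l - t j.+1) ^+ 2)) //.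
  rewrite mulr_sumr mulr_suml; apply: eq_bigr => j _.
  by rewrite /level -/u; case: ifP => _; rewrite ?expr_div_n; ring.
have -> : \sum_(j < n) t j.+1 * level i l j
        = (\sum_(j < i) t j.+1 * (l - t j.+1)) / (M * u ^+ 2).
  rewrite -(sum_prefix (fun j => t j.+1 * (l - t j.+1))) //.
  rewrite mulr_suml; apply: eq_bigr => j _.
  by rewrite /level -/u; case: ifP => _; ring.
have -> : A i * l ^+ 2 - Bt i = (\sum_(j < i) (l ^+ 2 - t j.+1 ^+ 2)) / M.
  by rewrite coefBtE /Defs.coefA sumrB sumr_const card_ord -[l ^+ 2 *+ i]mulr_natl; ring.
(* Since [M] is 2 N V, the squares account for the variance term of the cost and the products for
   its linear term. *)
have -> : \sum_(j < i) (l ^+ 2 - t j.+1 ^+ 2) =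
    \sum_(j < i) (l - t j.+1) ^+ 2 + 2 * \sum_(j < i) t j.+1 * (l - t j.+1).
  by rewrite mulr_sumr -big_split; apply: eq_bigr => j _ /=; ring.
have MN : M = 2 * N * V by [].
have N0 : N != 0 by rewrite pnatr_eq0.
rewrite MN in M0 *; have V0' := lt0r_neq0 V0.
by field; rewrite u0 V0' addrC natr1 N0.
Qed.

(* Convexity of z |-> N V u^2 z^2 + t_j z at the level of user j, where the
   derivative is l if j is served and t_j >= l otherwise. *)
Lemma cost_ge_OBJ i l (z : 'I_n -> R) :
  (i <= n)%N -> 0 < slope i l ->
  (forall j, (j < i)%N -> t j.+1 <= l) ->
  (forall j, (i <= j < n)%N -> l <= t j.+1) ->
  (forall j, 0 <= z j) -> \sum_j z j = (slope i l)^-1 ->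
  (OBJ n V t i l <= acquisition_cost V (fun j : 'I_n => t j.+1) z)%E.
Proof.
move=> le_in u0 lo hi z0 Sz.
have un := lt0r_neq0 u0.
rewrite -cost_level // /acquisition_cost sum_level // Sz invr_eq0 (negbTE un).
rewrite lee_fin exprVn invrK; set u := slope i l in u0 un *.
have N0 : 0 < N by rewrite ltr0n.
have M0 := coefM_gt0.
rewrite !mulrDr -!addrA lerD2l !mulr_sumr -!big_split /=.
rewrite lerD2l -subr_ge0 -sumrB.
(* Lagrange multiplier: both vectors have total 1/u, so the terms l (z_j - y_j) cancel in the sum,
   and it suffices to compare coordinate by coordinate. *)
have L0 : \sum_(j < n) l * (z j - level i l j) = 0.
  by rewrite -mulr_sumr sumrB sum_level // Sz subrr mulr0.
rewrite -[leLHS]L0; apply: ler_sum => j _.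
have [ji|ij] := ltnP j i.
  have E : l = M * u ^+ 2 * level i l j + t j.+1.
    by rewrite /level ji -/u; field; rewrite un lt0r_neq0.
  rewrite {1}E -subr_ge0; set y := level i l j.
  have -> : M = 2 * N * V by [].
  have -> : N * u ^+ 2 * (z j ^+ 2 * V) + t j.+1 * z j
     - (N * u ^+ 2 * (y ^+ 2 * V) + t j.+1 * y)
     - (2 * N * V * u ^+ 2 * y + t j.+1) * (z j - y)
     = N * V * u ^+ 2 * (z j - y) ^+ 2 by ring.
  by rewrite mulr_ge0 ?sqr_ge0 // !mulr_ge0 // ltW.
rewrite /level ltnNge ij /= !(expr0n, mul0r, mulr0, subr0, addr0) /=.
rewrite -[leLHS]add0r lerD //.
  by rewrite !mulr_ge0 ?z0 // ltW.
by rewrite ler_wpM2r // hi // ij ltn_ord.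
Qed.

Hypothesis t_mono : forall j k, (1 <= j <= k)%N -> (k <= n)%N -> t j <= t k.

Lemma slope_ge0 i l : (1 <= i <= n)%N -> t i <= l -> 0 <= slope i l.
Proof.
move=> /andP[i1 le_in] til; rewrite slopeE.
apply: divr_ge0; last exact: ltW coefM_gt0.
apply: sumr_ge0 => j _; rewrite subr_ge0 (le_trans _ til) // t_mono //.
exact: ltn_ord.
Qed.

Lemma coefA_gt0 i : (0 < i)%N -> 0 < A i.
Proof. by move=> i0; rewrite divr_gt0 ?coefM_gt0 ?ltr0n. Qed.

Lemma level_ge0 i l j : (1 <= i <= n)%N -> t i <= l -> 0 <= level i l j.
Proof.
move=> /andP[i1 le_in] til; rewrite /level; case: ifP => // ji.
apply: divr_ge0; last by rewrite mulr_ge0 ?sqr_ge0 // ltW // coefM_gt0.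
rewrite subr_ge0.
by rewrite (le_trans _ til) // t_mono.
Qed.

(** Through consecutive brackets the slope grows continuously from 0 at [t 1], without bound on the
    last one. The index sought is the last one whose left end has slope at most u. *)
Lemma exists_slope (u : R) : (0 < n)%N -> 0 < u ->
  exists i l, [/\ (1 <= i <= n)%N, bracket n t i l & slope i l = u].
Proof.
move=> n0 u0.
pose Q k := (1 <= k <= n)%N && (slope k (t k) <= u).
have exQ : exists k, Q k.
  exists 1; rewrite /Q n0 /= slopeE big_ord1 subrr mul0r; exact: ltW.
have ubQ k : Q k -> (k <= n)%N by case/andP => /andP[].
have [i /andP[i1n iu] imax] := ex_maxnP exQ ubQ.
have /andP[i1 le_in] := i1n.
have Ai := coefA_gt0 i1.
exists i, ((u + B i) / A i); split=> //; last by field; exact: lt0r_neq0.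
split; first by rewrite ler_pdivlMr // -lerBlDr.
move=> lt_in; rewrite ler_pdivrMr // -lerBrDr leNgt; apply/negP => lt_u.
(* The slopes of indices i and i+1 agree at [t i.+1], where the added term is 0; overshooting the
   bracket would contradict the maximality of i. *)
have /imax : Q i.+1.
  rewrite /Q ltnS leq0n lt_in /= (le_trans _ (ltW lt_u)) // !slopeE.
  by rewrite big_ord_recr /= subrr addr0.
by rewrite ltnn.
Qed.

Lemma exists_OBJ_le (z : 'I_n -> R) : (0 < n)%N ->
  (forall j, 0 <= z j) -> \sum_j z j != 0 ->
  exists i l, [/\ (1 <= i <= n)%N, bracket n t i l, 0 < slope i l &
    (OBJ n V t i l <= acquisition_cost V (fun j : 'I_n => t j.+1) z)%E].
Proof.
move=> n0 z0 Sz.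
have S0 : 0 < \sum_j z j by rewrite lt0r Sz sumr_ge0.
have [|i [l [i1n [til tSl] ul]]] := @exists_slope (\sum_j z j)^-1 n0.
  by rewrite invr_gt0.
have /andP[i1 le_in] := i1n.
have u0 : 0 < slope i l by rewrite ul invr_gt0.
exists i, l; split => //; apply: cost_ge_OBJ => // [j ji|j /andP[ij jn]|].
- by rewrite (le_trans _ til) // t_mono.
- by rewrite (le_trans (tSl _)) ?(leq_ltn_trans ij) // t_mono //= ltnS.
- by rewrite ul invrK.
Qed.

End Levels.

(** * The stationary points of the objective *)

Section Quartic.
Context (R : realType) (p q : R).

(* Up to the factor 2 (n + 1) and an additive constant, this is OBJ as a function of
   u = lambda A - B; its derivative is 2 (u^4 - p u + q) / u^3. *)
Definition slope_cost (x : R) : R := x ^+ 2 + 2 * p / x - q / x ^+ 2.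

Definition quartic (x : R) : R := x ^+ 4 - p * x + q.

Definition ferrari_disc : R :=
  p * p / 16 * (p * p / 16) - q / 3 * (q / 3) * (q / 3).

Definition ferrari_root : R :=
  let h := p * p / 16 in
  let s := Num.sqrt ferrari_disc in
  let m2 := 2 * ((h + s) `^ 3^-1 + (h - s) `^ 3^-1) in
  let w := Num.sqrt m2 in
  (w + Num.sqrt (2 * p / w - m2)) / 2.

Hypotheses (p0 : 0 < p) (q0 : 0 <= q).

(** Plays the part of the mean value theorem: for a < b the sign of the difference is that of the
    last factor. *)
Let slope_costB (a b : R) : 0 < a -> 0 < b ->
  slope_cost b - slope_cost a =
  (b - a) / (a * b) ^+ 2 * ((a + b) * ((a * b) ^+ 2 + q) - 2 * p * (a * b)).
Proof.
move=> a0 b0; rewrite /slope_cost; field.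
by rewrite !lt0r_neq0.
Qed.

(* The geometric mean of a and b is a suitable point. *)
Lemma slope_cost_decr (a b : R) : 0 < a -> a < b -> slope_cost b < slope_cost a ->
  exists2 x, a < x < b & quartic x < 0.
Proof.
move=> a0 ab; have b0 := lt_trans a0 ab.
have ab0 : 0 < a * b by rewrite mulr_gt0.
rewrite -subr_lt0 slope_costB // pmulr_rlt0; last first.
  by rewrite divr_gt0 ?exprn_gt0 // subr_gt0.
rewrite subr_lt0 => lt_p.
pose x := Num.sqrt (a * b).
have x2 : x ^+ 2 = a * b by rewrite sqr_sqrtr // ltW.
have x0 : 0 < x by rewrite sqrtr_gt0.
exists x; first by apply/andP; split; nra.
rewrite -x2 in lt_p; rewrite /quartic.
have le_x : 2 * x <= a + b.
  rewrite -(@ler_pXn2r _ 2) ?nnegrE ?mulr_ge0 ?addr_ge0 ?ltW //.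
  rewrite exprMn x2; nra.
have lt_xp : 2 * x * ((x ^+ 2) ^+ 2 + q) < 2 * p * x ^+ 2.
  by rewrite (le_lt_trans _ lt_p) // ler_wpM2r // addr_ge0 ?sqr_ge0.
have : 2 * x * (x ^+ 4 - p * x + q) < 0.
  have -> : 2 * x * (x ^+ 4 - p * x + q) =
      2 * x * ((x ^+ 2) ^+ 2 + q) - 2 * p * x ^+ 2 by ring.
  by rewrite subr_lt0.
by rewrite pmulr_rlt0 // mulr_gt0.
Qed.

(** The last factor of the difference is at most b [quartic a] + a [quartic b]. Information at the
    end points suffices later, because the quartic is nonpositive on a whole interval ending at the
    largest root. *)
Lemma slope_cost_incr (a b : R) : 0 < a -> a < b -> slope_cost a < slope_cost b ->
  0 < quartic a \/ 0 < quartic b.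
Proof.
move=> a0 ab; have b0 := lt_trans a0 ab.
have ab0 : 0 < a * b by rewrite mulr_gt0.
rewrite -subr_gt0 slope_costB // pmulr_rgt0; last first.
  by rewrite divr_gt0 ?exprn_gt0 // subr_gt0.
have -> : (a + b) * ((a * b) ^+ 2 + q) - 2 * p * (a * b) =
    b * quartic a + a * quartic b - a * b * ((a + b) * (a - b) ^+ 2).
  by rewrite /quartic; ring.
move=> gt0; apply/orP; rewrite -[_ || _]negbK negb_or -!leNgt.
apply/negP => /andP[ga gb]; move: gt0; apply/negP; rewrite -leNgt.
rewrite subr_le0 (@le_trans _ _ 0) //; last first.
  by rewrite mulr_ge0 ?(ltW ab0) // mulr_ge0 ?sqr_ge0 // addr_ge0 // ltW.
by rewrite -[0]addr0 lerD // mulr_ge0_le0 // ltW.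
Qed.

(** From p x >= x^4 + 3 (q/3), taking fourth powers and cancelling x^4 leaves p^4 >= 256 (q/3)^3,
    which is the claim multiplied by 256 = 16^2. *)
Lemma ferrari_disc_ge0 (x : R) : 0 < x -> quartic x <= 0 -> 0 <= ferrari_disc.
Proof.
move=> x0; rewrite /quartic => gx.
have x4 : 0 < x ^+ 4 by rewrite exprn_gt0.
have le1 : x ^+ 4 + 3 * (q / 3) <= p * x.
  by rewrite [3 * _]mulrC divfK ?pnatr_eq0 //; move: gx; rewrite -addrAC subr_le0.
have y0 : 0 <= q / 3 by rewrite divr_ge0.
rewrite /ferrari_disc; move: (q / 3) (x ^+ 4) (exprMn 4 p x) y0 x4 le1.
move=> y X pX y0 x4 le1.
have Xy0 : 0 <= X + 3 * y by rewrite addr_ge0 ?(ltW x4) // mulr_ge0.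
(* AM-GM for X and three copies of y. *)
have le4 : (X + 3 * y) ^+ 4 <= (p * x) ^+ 4.
  by rewrite ler_pXn2r // nnegrE ltW // mulr_gt0.
have amgm : 256 * X * y ^+ 3 <= (X + 3 * y) ^+ 4.
  rewrite -subr_ge0.
  have -> : (X + 3 * y) ^+ 4 - 256 * X * y ^+ 3 =
     (X - y) ^+ 2 * (X ^+ 2 + 14 * X * y + 81 * y ^+ 2) by ring.
  have X0 := ltW x4.
  by rewrite mulr_ge0 ?sqr_ge0 // !addr_ge0 ?sqr_ge0 // ?mulr_ge0 ?sqr_ge0.
have : 0 <= X * (p ^+ 4 - 256 * y ^+ 3).
  by rewrite mulrBr subr_ge0 [leRHS]mulrC -pX mulrCA mulrA (le_trans amgm).
rewrite pmulr_rge0 // subr_ge0 => le_p; lra.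
Qed.

Let cbrtK (a : R) : 0 <= a -> (a `^ 3^-1) ^+ 3 = a.
Proof.
move=> a0; rewrite -powR_mulrn ?powR_ge0 // -powRrM mulVf ?powRr1 //.
Qed.

(** Cardano's formula gives m, and the quartic splits into two real quadratics. One has positive
    coefficients, hence no positive root; the roots of the other are v and [ferrari_root]. *)
Lemma ferrari : 0 <= ferrari_disc ->
  0 < ferrari_root /\
  exists v w a, [/\ v <= ferrari_root, 0 < w, 0 < a &
    forall x, quartic x = (x - ferrari_root) * (x - v) * (x ^+ 2 + w * x + a)].
Proof.
move=> disc0; rewrite /ferrari_root; lazy zeta.
set h := p * p / 16; set s := Num.sqrt ferrari_disc.
set r := (h + s) `^ _; set r' := (h - s) `^ _.
have s0 : 0 <= s by rewrite sqrtr_ge0.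
have h0 : 0 < h by rewrite divr_gt0 ?mulr_gt0.
have s2 : s ^+ 2 = h ^+ 2 - (q / 3) ^+ 3.
  by rewrite sqr_sqrtr // /ferrari_disc -/h; ring.
have y0 : 0 <= (q / 3) ^+ 3 by rewrite exprn_ge0 // divr_ge0.
(* As q >= 0, both cube roots are taken of nonnegative numbers, where the real power is a genuine
   cube root. *)
have sh : 0 <= h - s by rewrite subr_ge0 -(@ler_pXn2r _ 2) ?nnegrE ?(ltW h0) //; lra.
have hs : 0 < h + s by rewrite ltr_wpDr.
have r3 : r ^+ 3 = h + s by rewrite cbrtK // ltW.
have r3' : r' ^+ 3 = h - s by rewrite cbrtK.
have r0 : 0 < r by rewrite powR_gt0.
have r0' : 0 <= r' by rewrite powR_ge0.
(* The pairing of the two cube roots required by Cardano: their cubes multiply to h^2 - s^2 =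
   (q/3)^3. *)
have rr : r * r' = q / 3.
  apply: (@pexpIrn _ 3) => //; rewrite ?nnegrE ?divr_ge0 ?mulr_ge0 ?(ltW r0) //.
  by rewrite exprMn r3 r3' mulrC -subr_sqr s2; ring.
set m := r + r'.
have m0 : 0 < m by rewrite ltr_wpDr.
have m3 : m ^+ 3 = p ^+ 2 / 8 + q * m.
  have -> : m ^+ 3 = r ^+ 3 + r' ^+ 3 + 3 * (r * r') * m by rewrite /m; ring.
  by rewrite r3 r3' rr /h; field.
(* The power mean inequality for r and r', whose cubes add up to 2 h = p^2/8. It yields m w <= p,
   that is, a nonnegative discriminant for the first quadratic. *)
have m3_le : m ^+ 3 <= p ^+ 2 / 2.
  have : m ^+ 3 <= 4 * (r ^+ 3 + r' ^+ 3).
    rewrite -subr_ge0 /m.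
    have -> : 4 * (r ^+ 3 + r' ^+ 3) - (r + r') ^+ 3
      = 3 * (r + r') * (r - r') ^+ 2 by ring.
    by rewrite mulr_ge0 ?sqr_ge0 // mulr_ge0 // addr_ge0 // ltW.
  by rewrite r3 r3' /h; lra.
set w := Num.sqrt (2 * m).
have w2 : w ^+ 2 = 2 * m by rewrite sqr_sqrtr // mulr_ge0 ?ltW.
have w0 : 0 < w by rewrite sqrtr_gt0 mulr_gt0.
have mw : m * w <= p.
  rewrite -(@ler_pXn2r _ 2) ?nnegrE ?mulr_ge0 ?(ltW m0) ?(ltW w0) ?(ltW p0) //.
  have -> : (m * w) ^+ 2 = 2 * m ^+ 3 by rewrite exprMn w2; ring.
  by rewrite mulrC -ler_pdivlMr.
set e := 2 * p / w - 2 * m.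
have e0 : 0 <= e by rewrite subr_ge0 ler_pdivlMr // -mulrA ler_pM2l.
set z := Num.sqrt e.
have z0 : 0 <= z by rewrite sqrtr_ge0.
have z2 : z ^+ 2 = e by rewrite sqr_sqrtr.
split; first by rewrite divr_gt0 // ltr_wpDr.
(* The quartic is (x^2 - w x + (w^2 - p/w) / 2) (x^2 + w x + (w^2 + p/w) / 2). *)
exists ((w - z) / 2), w, ((w ^+ 2 + p / w) / 2); split=> //.
- by rewrite ler_pM2r // lerD2l; lra.
- by rewrite divr_gt0 // addr_gt0 ?exprn_gt0 ?divr_gt0.
move=> x; set a := _ / 2.
have -> : (x - (w + z) / 2) * (x - (w - z) / 2) =
          x ^+ 2 - w * x + (w ^+ 2 - z ^+ 2) / 4 by field.
have wn := lt0r_neq0 w0; have mn := lt0r_neq0 m0.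
have -> : (w ^+ 2 - z ^+ 2) / 4 = (w ^+ 2 - p / w) / 2.
  by rewrite z2 /e w2; field.
(* The product of the two constant terms equals q precisely because m solves the resolvent cubic. *)
have -> : quartic x = x ^+ 4 - p * x + (w ^+ 4 - p ^+ 2 / w ^+ 2) / 4.
  rewrite /quartic; congr (_ + _).
  have -> : w ^+ 4 = 4 * m ^+ 2 by rewrite (exprM w 2 2) w2; ring.
  rewrite w2.
  have -> : q = (m ^+ 3 - p ^+ 2 / 8) / m by rewrite m3; field.
  by field.
by rewrite /a; field.
Qed.

(* The largest root u is the only local minimum of slope_cost: the quartic is negative
   between the other root v and u, and positive elsewhere. If a = 0, slope_cost is
   regarded as +oo at a, which is right when q = 0. *)
Lemma slope_cost_root (a y : R) : 0 <= a -> a < y ->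
  (if a == 0 then q = 0 else slope_cost y < slope_cost a) ->
  [/\ 0 <= ferrari_disc, a < ferrari_root,
      slope_cost ferrari_root <= slope_cost y
    & forall b, y < b -> slope_cost y < slope_cost b -> ferrari_root < b].
Proof.
move=> a0 ay ha; have y0 := le_lt_trans a0 ay.
have dip : a != 0 -> exists2 x, a < x < y & quartic x < 0.
  move=> an; rewrite (negbTE an) in ha.
  by apply: slope_cost_decr => //; rewrite lt0r an.
have disc0 : 0 <= ferrari_disc.
  have [a_eq0|an] := eqVneq a 0.
    move: ha; rewrite a_eq0 eqxx /ferrari_disc => ->.
    by rewrite mul0r mulr0 subr0 -expr2 sqr_ge0.
  have [x /andP[ax _] gx] := dip an.
  by apply: (@ferrari_disc_ge0 x); rewrite ?(le_lt_trans a0 ax) // ltW.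
have [u0 [v [w [k [vu w0 k0 gE]]]]] := ferrari disc0.
move: (ferrari_root) u0 vu gE => u u0 vu gE.
have c0 x : 0 < x -> 0 < x ^+ 2 + w * x + k.
  by move=> x0; rewrite !addr_gt0 ?mulr_gt0 ?exprn_gt0.
have gneg x : 0 < x -> v < x -> x <= u -> quartic x <= 0.
  move=> x0 vx xu; rewrite gE -mulrA mulr_le0_ge0 ?subr_le0 //.
  by rewrite mulr_ge0 ?subr_ge0 ?(ltW vx) // ltW // c0.
have gpos x : u < x -> 0 <= quartic x.
  move=> ux; have x0 := lt_trans u0 ux; rewrite gE.
  by rewrite !mulr_ge0 ?subr_ge0 ?(le_trans vu) ?(ltW ux) // ltW // c0.
(* If a = 0, then q = 0 and evaluating the factorisation at 0 gives v = 0. Otherwise the cost drops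
   between a and y, so the quartic is negative at some point there, and this point lies between v
   and u. *)
have [vy au] : v < y /\ a < u.
  have [a_eq0|an] := eqVneq a 0.
    move: ha (gE 0); rewrite a_eq0 eqxx /quartic => ->.
    rewrite !(expr0n, mulr0, sub0r, add0r, addr0, subr0) /= => /esym/eqP.
    rewrite oppr0 mulf_eq0 mulrNN mulf_eq0 (gt_eqF u0) (gt_eqF k0) orbF /= => /eqP ->.
    by split.
  have [x /andP[ax xy] gx] := dip an.
  have x0 := le_lt_trans a0 ax.
  move: gx; rewrite gE pmulr_llt0 ?c0 // => gx.
  have [vx xu] : v < x /\ x < u by split; rewrite ltNge; apply/negP => H; nra.
  by split; [exact: lt_trans vx xy | exact: lt_trans ax xu].
split=> //.
  (* If y < u, the quartic is nonpositive at y and at u, which excludes an increase. If u < y, a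
     decrease would require a negative value beyond u. *)
  rewrite leNgt; apply/negP => lt_yu.
  have [yu|uy|yu] := ltgtP y u.
  - have [] := slope_cost_incr y0 yu lt_yu; rewrite ltNge gneg ?(lt_trans vy yu) ?(ltW yu) //.
  - have [x /andP[ux _]] := slope_cost_decr u0 uy lt_yu.
    by rewrite ltNge gpos.
  - by rewrite yu ltxx in lt_yu.
move=> b yb lt_yb; rewrite ltNge; apply/negP => bu.
have [] := slope_cost_incr y0 yb lt_yb; rewrite ltNge gneg //.
- exact: le_trans (ltW yb) bu.
- exact: lt_trans y0 yb.
- exact: lt_trans vy yb.
Qed.

End Quartic.

(** * The program *)

Section Exec.
Context (R : realType) (I : Type) (F f : I -> R -> R).
Local Notation exec := (exec F f).

Lemma exec_bind A A' (p : prog I R A) (q : A -> prog I R A') :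
  exec (bind p q) =
  ((exec (q (exec p).1)).1, ((exec p).2 + (exec (q (exec p).1)).2)%N).
Proof.
by elim: p => /= [a|p ->|m k IH|o x y k IH|x k IH|x k IH|i x k IH|i x k IH|x y k IH];
  rewrite ?IH // -surjective_pairing.
Qed.

Lemma exec_bind1 A A' (p : prog I R A) (q : A -> prog I R A') :
  (exec (bind p q)).1 = (exec (q (exec p).1)).1.
Proof. by rewrite exec_bind. Qed.

Lemma exec_bind2 A A' (p : prog I R A) (q : A -> prog I R A') :
  (exec (bind p q)).2 = ((exec p).2 + (exec (q (exec p).1)).2)%N.
Proof. by rewrite exec_bind. Qed.

Definition obj (N A B Bt l : R) : R :=
  2 * N * (l * A - B) ^+ 2 + (A * l ^+ 2 - Bt) / (2 * (l * A - B) ^+ 2).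

Lemma exec_consider N A B Bt l : (exec (consider I N A B Bt l)).1 =
  if l * A - B <= 0 then None
  else Some (Candidate l (l * A - B) (obj N A B Bt l)).
Proof.
rewrite /consider /=; case: ifP => //= _; congr (Some (Candidate _ _ _)).
by rewrite /obj !expr2 !mulrA.
Qed.

Lemma exec_stationary N A B Bt :
  let p := B / (4 * (N * A)) in
  let q := (A * Bt - B * B) / (4 * (N * A)) in
  (exec (stationary I N A B Bt)).1 =
  if 0 <= ferrari_disc p q then Some ((ferrari_root p q + B) / A) else None.
Proof.
move=> p q; rewrite /stationary /= -/p -/q -/(ferrari_disc p q).
by case: (0 <= _).
Qed.

(** * Minimisation over one bracket *)

Section SolveBracket.
Variables (N A B Bt lo : R) (hi : option R).
Hypotheses (N0 : 0 < N) (A0 : 0 < A).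

Definition below (l : R) := if hi is Some r then l <= r else true.

Definition sound (c : option (candidate R)) : Prop :=
  if c is Some k then
    [/\ lo <= cand_point k, below (cand_point k), 0 < cand_slope k,
        cand_slope k = cand_point k * A - B
      & cand_value k = obj N A B Bt (cand_point k)]
  else True.

Definition beats (c : option (candidate R)) (v : R) : Prop :=
  if c is Some k then cand_value k <= v else False.

Lemma sound_consider l : lo <= l -> below l ->
  sound (exec (consider I N A B Bt l)).1.
Proof.
by move=> lol lhi; rewrite exec_consider; case: ifP => //= /negbT; rewrite -ltNge.
Qed.

Lemma beats_consider l v : 0 < l * A - B -> obj N A B Bt l <= v ->
  beats (exec (consider I N A B Bt l)).1 v.
Proof. by move=> u0 le_v; rewrite exec_consider leNgt u0. Qed.

Lemma sound_better c1 c2 : sound c1 -> sound c2 ->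
  sound (exec (better I c1 c2)).1.
Proof. by case: c1 c2 => [a|] [b|] //=; case: ifP. Qed.

Lemma beats_better c1 c2 v : beats c1 v \/ beats c2 v ->
  beats (exec (better I c1 c2)).1 v.
Proof.
case: c1 c2 => [a|] [b|] /=; try by case.
case: ifP => [ab|/negbT]; first by case=> // /(le_trans ab).
by rewrite -ltNge => /ltW ba; case=> // /(le_trans ba).
Qed.

(** Origin of p and q: with l = (u + B) / A, the fraction in [obj] becomes 1/(2A) + B/(A u) - (A Bt
    - B^2)/(2 A u^2). *)
Lemma obj_slope_cost l : l * A - B != 0 ->
  obj N A B Bt l = 2 * N * slope_cost (B / (4 * (N * A)))
     ((A * Bt - B * B) / (4 * (N * A))) (l * A - B) + (2 * A)^-1.
Proof.
move=> u0; rewrite /obj /slope_cost.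
have -> : A * l ^+ 2 = (l * A - B + B) ^+ 2 / A by field; rewrite lt0r_neq0.
by field; rewrite u0 !lt0r_neq0.
Qed.

Hypothesis slope_lo : 0 <= lo * A - B.

Let exec_solve_bracket : (exec (solve_bracket I N A B Bt lo hi)).1 =
  if B <= 0 then None else
  let c1 := (exec (consider I N A B Bt lo)).1 in
  let c2 := if hi is Some r then (exec (consider I N A B Bt r)).1 else None in
  let c12 := (exec (better I c1 c2)).1 in
  if (exec (stationary I N A B Bt)).1 is Some l then
    if (lo <= l) && below l then
      (exec (better I c12 (exec (consider I N A B Bt l)).1)).1
    else c12
  else c12.
Proof.
rewrite /solve_bracket.
move: (stationary I N A B Bt) (consider I N A B Bt) => st co.
rewrite exec_bind1 exec_bind1 /=; case: ifP => //= _; rewrite !exec_bind1.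
have -> : (exec (if hi is Some r then co r else Ret None)).1 =
          if hi is Some r then (exec (co r)).1 else None.
  by case: hi.
case: (exec st).1 => [l|] //=; rewrite exec_bind1 /=.
have -> : (exec (if hi is Some r then leqK I l r else Ret true)).1 = below l.
  by rewrite /below; case: hi.
by case: (_ && _); rewrite // exec_bind1.
Qed.

Lemma sound_solve_bracket : below lo ->
  sound (exec (solve_bracket I N A B Bt lo hi)).1.
Proof.
move=> lohi; rewrite exec_solve_bracket; case: (B <= 0) => //; lazy zeta.
have s12 : sound (exec (better I (exec (consider I N A B Bt lo)).1
    (if hi is Some r then (exec (consider I N A B Bt r)).1 else None))).1.
  apply: sound_better; first exact: sound_consider.
  by move: lohi sound_consider; rewrite /below; case: hi => //= r lr; exact.
case: (exec (stationary I N A B Bt)).1 => [l|] //.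
case: ifP => // /andP[lol lhi].
by apply: sound_better => //; apply: sound_consider.
Qed.

(** If neither end does as well as y, then y sits in a dip of the cost. [slope_cost_root] then
    places the largest root strictly inside the bracket, with a value no worse than at y. *)
Lemma beats_solve_bracket y : 0 < B -> B * B <= A * Bt ->
  (lo * A - B = 0 -> A * Bt = B * B) ->
  lo <= y -> below y -> 0 < y * A - B ->
  beats (exec (solve_bracket I N A B Bt lo hi)).1 (obj N A B Bt y).
Proof.
move=> B0 q0 qlo loy yhi uy.
rewrite exec_solve_bracket leNgt B0 exec_stationary; lazy zeta iota delta [negb].
set c1 := (exec (consider I N A B Bt lo)).1.
set c2 := if hi is Some r then _ else _.
set c12 := (exec (better I c1 c2)).1.
set p := B / _; set q := _ / _; set sc := slope_cost p q.
have NA0 : 0 < 4 * (N * A) by rewrite !mulr_gt0.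
have p0 : 0 < p by rewrite divr_gt0.
have q0' : 0 <= q by rewrite divr_ge0 ?subr_ge0 ?(ltW NA0).
have le_obj l : 0 < l * A - B -> sc (l * A - B) <= sc (y * A - B) ->
    obj N A B Bt l <= obj N A B Bt y.
  move=> ul le_sc; rewrite !obj_slope_cost ?lt0r_neq0 // lerD2r ler_pM2l //.
  by rewrite mulr_gt0.
have slope_lt l m : l < m -> l * A - B < m * A - B.
  by move=> lm; rewrite ltrD2r ltr_pM2r.
have final b l : beats c12 (obj N A B Bt y) ->
    beats (if b then (exec (better I c12 (exec (consider I N A B Bt l)).1)).1
           else c12) (obj N A B Bt y).
  by move=> b12; case: b => //; apply: beats_better; left.
have finish : beats c12 (obj N A B Bt y) -> beats
   match (if 0 <= ferrari_disc p q then Some ((ferrari_root p q + B) / A) else None) with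
   | Some l => if (lo <= l) && below l then
       (exec (better I c12 (exec (consider I N A B Bt l)).1)).1 else c12
   | None => c12 end (obj N A B Bt y).
  by move=> b12; case: ifP => // _; exact: final.
have [b1|nb1] := pselect (0 < lo * A - B /\ sc (lo * A - B) <= sc (y * A - B)).
  apply: finish; apply: beats_better; left.
  by case: b1 => u le_sc; apply: beats_consider => //; exact: le_obj.
have [[r [hir yr le_sc]]|nb2] := pselect
    (exists r, [/\ hi = Some r, y <= r & sc (r * A - B) <= sc (y * A - B)]).
  apply: finish; apply: beats_better; right; rewrite /c2 hir.
  have ur : 0 < r * A - B.
    by rewrite (lt_le_trans uy) // lerD2r ler_wpM2r // ltW.
  by apply: beats_consider => //; exact: le_obj.
have loy' : lo < y.
  rewrite lt_def loy andbT; apply/eqP => ylo; apply: nb1.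
  by rewrite -ylo.
(* A left end of slope 0 yields no candidate; there the equality case of Cauchy-Schwarz provides q =
   0 instead of a comparison of costs. *)
have [] := slope_cost_root p0 q0' slope_lo (slope_lt _ _ loy').
  case: eqP => [/qlo|/eqP un].
    by move=> qeq; rewrite /q qeq subrr mul0r.
  rewrite ltNge; apply/negP => le_sc; apply: nb1.
  by rewrite lt0r un slope_lo.
move=> -> lo_root le_sc root_hi.
set l := (ferrari_root p q + B) / A.
have lE : l * A - B = ferrari_root p q by rewrite /l divfK ?addrK // lt0r_neq0.
have -> : lo <= l by rewrite -(ler_pM2r A0) -(lerD2r (- B)) lE ltW.
have -> : below l.
  rewrite /below; case Ehi: hi => [r|] //.
  rewrite -(ler_pM2r A0) -(lerD2r (- B)) lE ltW // root_hi //.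
    apply: slope_lt; rewrite lt_neqAle; move: yhi; rewrite /below Ehi => yr.
    rewrite yr andbT; apply/eqP => yEr; apply: nb2; exists r.
    by split=> //; rewrite yEr.
  rewrite ltNge; apply/negP => le_sc'; apply: nb2; exists r.
  by split=> //; move: yhi; rewrite /below Ehi.
apply: beats_better; right; apply: beats_consider.
  by rewrite lE (le_lt_trans slope_lo).
by apply: le_obj; rewrite lE // (le_lt_trans slope_lo).
Qed.

End SolveBracket.
End Exec.

(** * Correctness of the pass over the sorted costs *)

Section Scan.
Context (R : realType) (I : Type) (F f : I -> R -> R).
Context (n : nat) (V : R) (t : nat -> R).
Hypothesis V0 : 0 < V.
Hypothesis t_mono : forall j k, (1 <= j <= k)%N -> (k <= n)%N -> t j <= t k.

Local Notation exec := (exec F f).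
Local Notation N := (n.+1%:R : R).
Local Notation M := (Defs.coefM n V).
Local Notation A := (Defs.coefA n V).
Local Notation B := (Defs.coefB n V t).
Local Notation Bt := (coefBt n V t).
Local Notation slope i l := (l * A i - B i).

Lemma OBJ_obj i l : slope i l != 0 ->
  OBJ n V t i l = (obj N (A i) (B i) (Bt i) l)%:E.
Proof. by move=> u0; rewrite /OBJ (negbTE u0). Qed.

Lemma sum_sqr_dev i l :
  A i * l ^+ 2 - 2 * B i * l + Bt i = (\sum_(j < i) (l - t j.+1) ^+ 2) / M.
Proof.
rewrite coefBE coefBtE /Defs.coefA.
have -> : \sum_(j < i) (l - t j.+1) ^+ 2 =
    \sum_(j < i) l ^+ 2 - 2 * l * (\sum_(j < i) t j.+1) + \sum_(j < i) t j.+1 ^+ 2.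
  by rewrite mulr_sumr -sumrB -big_split /=; apply: eq_bigr => j _; ring.
by rewrite sumr_const card_ord -mulr_natl; ring.
Qed.

(** Cauchy-Schwarz, obtained from [sum_sqr_dev] at [B i / A i], the mean of the first i costs. *)
Lemma coefB_cauchy i : (0 < i)%N -> B i * B i <= A i * Bt i.
Proof.
move=> i0; have A0 := coefA_gt0 n V0 i0.
rewrite -subr_ge0.
have -> : A i * Bt i - B i * B i =
    A i * (A i * (B i / A i) ^+ 2 - 2 * B i * (B i / A i) + Bt i).
  by field; exact: lt0r_neq0.
rewrite sum_sqr_dev mulr_ge0 ?(ltW A0) //; apply: divr_ge0.
  by apply: sumr_ge0 => j _; exact: sqr_ge0.
exact: ltW (coefM_gt0 n V0).
Qed.

(** The slope is a sum of nonnegative gaps [t i - t j.+1]; if it vanishes, all the costs coincide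
    and Cauchy-Schwarz is an equality. *)
Lemma coefB_cauchy_eq i : (1 <= i <= n)%N -> slope i (t i) = 0 ->
  A i * Bt i = B i * B i.
Proof.
move=> /andP[i1 le_in] s0; have M0 := coefM_gt0 n V0.
have tj (j : 'I_i) : t i - t j.+1 = 0.
  apply: (psumr_eq0P (P := xpredT) (F := fun j : 'I_i => t i - t j.+1)) => //.
    by move=> k _; rewrite subr_ge0 t_mono //=.
  by move/eqP: s0; rewrite slopeE mulf_eq0 invr_eq0 (gt_eqF M0) orbF => /eqP.
have := sum_sqr_dev i (t i).
rewrite big1 ?mul0r => [|j _]; last by rewrite tj // expr0n.
have /eqP := s0; rewrite subr_eq0 => /eqP <-.
have -> : A i * t i ^+ 2 - 2 * (t i * A i) * t i + Bt i =
          Bt i - A i * t i ^+ 2 by ring.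
by move/eqP; rewrite subr_eq0 => /eqP ->; ring.
Qed.

Definition good i (b : option (candidate R * nat)) : Prop :=
  if b is Some (c, k) then
    [/\ (1 <= k <= i)%N, bracket n t k (cand_point c), 0 < cand_slope c,
        cand_slope c = slope k (cand_point c)
      & OBJ n V t k (cand_point c) = (cand_value c)%:E]
  else True.

(** Limited to pairs with a finite objective and to indices that [solve_bracket] does not skip. The
    value at [None] makes the existence of a candidate part of the claim. *)
Definition covers i (b : option (candidate R * nat)) : Prop :=
  forall k l, (1 <= k <= i)%N -> bracket n t k l -> 0 < slope k l -> 0 < B k ->
  if b is Some (c, _) then is_true ((cand_value c)%:E <= OBJ n V t k l)%E
  else False.

Definition scan_inv i (st : scan_state R) : Prop :=
  [/\ kr st = i%:R, accB st = B i, accBt st = Bt i, idx st = i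
    & good i (best st) /\ covers i (best st)].

Lemma exec_scan_step (st : scan_state R) N' M' x hi :
  (exec (scan_step I N' M' st x hi)).1 =
  let k := kr st + 1 in
  let B' := accB st + x / M' in
  let Bt' := accBt st + x * x / M' in
  let c := (exec (solve_bracket I N' (k / M') B' Bt' x hi)).1 in
  ScanState k B' Bt' (idx st).+1
    (exec (update_best I (idx st).+1 (best st) c)).1.
Proof.
rewrite /scan_step; move: (solve_bracket I) => sb /=.
by rewrite exec_bind1 exec_bind1.
Qed.

Lemma scan_step_inv i st hi : (i < n)%N -> scan_inv i st ->
  hi = (if (i.+1 < n)%N then Some (t i.+2) else None) ->
  scan_inv i.+1 (exec (scan_step I N M st (t i.+1) hi)).1.
Proof.
move=> lt_in [krE BE BtE idxE [gd cv]] hiE.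
rewrite exec_scan_step krE BE BtE idxE natr1 -expr2; lazy zeta.
rewrite -[i.+1%:R / M]/(A i.+1) -[B i + _]/(B i.+1) -[Bt i + _]/(Bt i.+1).
set c := (exec (solve_bracket _ _ _ _ _ _ _)).1.
have i1 : (1 <= i.+1 <= n)%N by [].
have N0 : 0 < N by rewrite ltr0n.
have A0 := coefA_gt0 n V0 (ltn0Sn i).
have u0 := slope_ge0 V0 t_mono i1 (lexx _).
have hi_br l : bracket n t i.+1 l <-> t i.+1 <= l /\ below hi l.
  rewrite /bracket /below hiE /=; case: ifP => // _; split=> -[tl H]; split=> //.
  exact: H.
have lohi : below hi (t i.+1).
  by rewrite hiE /below; case: ifP => // ?; rewrite t_mono /=.
have snd : sound N (A i.+1) (B i.+1) (Bt i.+1) (t i.+1) hi c.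
  exact: sound_solve_bracket.
have bts l : bracket n t i.+1 l -> 0 < slope i.+1 l -> 0 < B i.+1 ->
    beats c (obj N (A i.+1) (B i.+1) (Bt i.+1) l).
  move=> /hi_br[tl hil] ul B0; apply: beats_solve_bracket => //.
    exact: coefB_cauchy.
  exact: coefB_cauchy_eq.
split=> //=.
have gd' : good i.+1 (best st).
  case: (best st) gd => //= -[b k] [/andP[k1 ki] ? ? ? ?]; split=> //.
  by rewrite k1 ltnW.
have gdc : good i.+1 (if c is Some d then Some (d, i.+1) else None).
  case: (c) snd => //= d [d1 d2 d3 d4 d5]; split=> //.
  - exact/hi_br.
  - by rewrite OBJ_obj ?d5 // -d4 lt0r_neq0.
split.
  case: (best st) gd' => [[b k]|]; case: (c) gdc => [d|] //= gdd gdb.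
  by case: ifP.
move=> k l /andP[k1]; rewrite leq_eqVlt => /orP[/eqP ->|ki] brk uk Bk.
  have := bts l brk uk Bk; rewrite OBJ_obj ?lt0r_neq0 //.
  case: (c) => //= d dl; case: (best st) => [[b kb]|] /=; rewrite ?lee_fin //.
  by case: ifP => // bd; rewrite lee_fin // (le_trans bd).
have := cv k l; rewrite k1 -ltnS ki => /(_ isT brk uk Bk).
case: (best st) => [[b kb]|] // bl; case: (c) => [d|] //=.
case: ifP => // /negbT; rewrite -ltNge => db.
by rewrite (le_trans _ bl) // lee_fin ltW.
Qed.

Lemma scan_inv_scan (s : seq (I * R)) i st : (i + size s = n)%N ->
  (forall j, (j < size s)%N -> nth 0 (unzip2 s) j = t (i + j).+1) ->
  scan_inv i st -> scan_inv n (exec (scan N M st s)).1.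
Proof.
elim: s i st => [|[a x] s IH] i st /=; first by rewrite addn0 => <-.
move=> size_s ts inv; rewrite exec_bind1.
have -> : x = t i.+1 by have := ts 0 isT; rewrite /= addn0.
apply: (IH i.+1) => [|j js|]; first by rewrite addSnnS.
  by have := ts j.+1 js; rewrite addnS.
apply: scan_step_inv => //; first by rewrite -size_s -addSnnS leq_addr.
case: s {IH} size_s ts => [|[b y] s] /= size_s ts.
  by rewrite -size_s addn1 ltnn.
have := ts 1 isT; rewrite /= addn1 => ->.
by have -> : (i.+1 < n)%N by lia.
Qed.

End Scan.

(** * Result and running time of the sort and of the whole program *)

Section Run.
Context (R : realType) (I : Type) (F f : I -> R -> R).
Local Notation exec := (exec F f).
Local Notation user := (I * R)%type.
Implicit Types (s : seq user) (ss : seq (seq user)).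

Definition le_cost (x y : user) := x.2 <= y.2.

Lemma exec_virtual_costs s : exec (virtual_costs s) =
  ([seq (x.1, virtual_cost (F x.1) (f x.1) x.2) | x <- s], (4 * size s).+1).
Proof.
elim: s => [|[i c] s IH] //=; rewrite exec_bind IH /pay /=.
by rewrite addn0 mulnS.
Qed.

Lemma exec_merge_costs s1 s2 :
  (exec (merge_costs s1 s2)).1 = path.merge le_cost s1 s2 /\
  ((exec (merge_costs s1 s2)).2 <= size s1 + size s2 + 1)%N.
Proof.
elim: s1 s2 => [|x1 s1 IH1] s2 /=; first by rewrite add0n addn1.
elim: s2 => [|x2 s2 IH2] /=; first by rewrite addn1.
rewrite -/(le_cost x1 x2); case: ifP => _; rewrite exec_bind /=.
  by have [-> H] := IH1 (x2 :: s2); split=> //; move: H => /=; lia.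
by have [-> H] := IH2; split=> //; move: H => /=; lia.
Qed.

Let push := merge_sort_push le_cost.
Let pop := merge_sort_pop le_cost.

Fixpoint weight (k : nat) ss : nat :=
  if ss is s :: ss' then (k * size s + weight k.+1 ss')%N else 0%N.

(* A list in position j of a stack has taken part in j merges, each at a cost
   proportional to its size: weight counts the comparisons already made. *)
Lemma exec_sort_push k s1 ss : (0 < size s1)%N ->
  (exec (sort_push s1 ss)).1 = push s1 ss /\
  ((exec (sort_push s1 ss)).2 + 2 * (weight k ss + k * size s1) <=
   2 * weight k (push s1 ss) + 1)%N.
Proof.
elim: ss k s1 => [|[|x s2] ss IH] k s1 s10 /=.
- by split=> //; lia.
- by split=> //; lia.
have [m1 m2] := exec_merge_costs (x :: s2) s1.
rewrite -/(merge_costs (x :: s2)) !exec_bind.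
set mc := exec (merge_costs (x :: s2) s1) in m1 m2 *.
have sm : size mc.1 = (size s2 + size s1).+1.
  by rewrite m1 size_merge size_cat.
have [|p1 p2] := IH k.+1 mc.1; first by rewrite sm.
rewrite -m1 /= -/push p1; split=> //.
(* The merged list has size S >= 2, so the tick and the merge cost at most S + 2 <= 2 S: twice the
   weight gained when S elements move up one position. *)
move: m2 p2; rewrite sm /=; lia.
Qed.

(** The stack behaves like a binary counter: position j holds nothing or at least 2^j elements. As
    the last position is occupied, the height is logarithmic. *)
Fixpoint graded (k : nat) ss : bool :=
  if ss is s :: ss' then
    [&& (size s == 0) || (2 ^ k <= size s), graded k.+1 ss'
      & (0 < size ss') || (0 < size s)]%N
  else true.

Lemma graded_push k s1 ss : (2 ^ k <= size s1)%N -> graded k ss ->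
  [/\ graded k (push s1 ss), (0 < size (push s1 ss))%N
    & sumn (shape (push s1 ss)) = (size s1 + sumn (shape ss))%N].
Proof.
elim: ss k s1 => [|[|x s2] ss IH] k s1 s1k /=.
- by rewrite s1k orbT; split=> //; apply: leq_trans s1k; rewrite expn_gt0.
- move=> /andP[g _]; rewrite s1k g orbT; split=> //.
  by rewrite (leq_trans _ s1k) ?expn_gt0 ?orbT.
case/and3P=> xk g _.
have [|//|g' sz sh] := IH k.+1 (path.merge le_cost (x :: s2) s1).
  by rewrite size_merge size_cat expnS /=; move: xk; rewrite /=; lia.
move: g' sz sh; rewrite /push /= => g' sz sh; rewrite g' sz; split=> //.
by rewrite sh size_merge size_cat /=; lia.
Qed.

Lemma graded_size k ss : graded k ss -> (0 < size ss)%N ->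
  (2 ^ (k + (size ss).-1) <= sumn (shape ss))%N.
Proof.
elim: ss k => [|s ss IH] k //= /and3P[sk g ne] _.
case: ss IH g ne => [|s' ss] IH g ne.
  by rewrite addn0 /= addn0; move: ne sk => /=; case: (size s).
by have := IH _ g isT; rewrite /= addSnnS; move/leq_trans; apply; exact: leq_addl.
Qed.

Lemma weight_le k ss : (weight k ss <= (k + size ss) * sumn (shape ss))%N.
Proof.
elim: ss k => [|s ss IH] k //=; have := IH k.+1.
by rewrite mulnDr addSnnS => H; apply: leq_add => //; rewrite leq_mul2r leq_addr orbT.
Qed.

Lemma exec_sort_pop s1 ss :
  (exec (sort_pop s1 ss)).1 = pop s1 ss /\
  ((exec (sort_pop s1 ss)).2 <=
    size ss * (size s1 + sumn (shape ss) + 2) + 1)%N.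
Proof.
elim: ss s1 => [|s2 ss IH] s1 //=.
have [m1 m2] := exec_merge_costs s2 s1; rewrite exec_bind.
have [p1 p2] := IH (exec (merge_costs s2 s1)).1.
rewrite p1 m1; split=> //=.
move: p2 m2; rewrite m1 size_merge size_cat; nia.
Qed.

(** Amortised analysis with potential [2 * weight 0 ss]: beyond the gain in potential, each element
    costs 2 units. At the end the potential is at most 2 L T and the pops cost at most L (T + 2) +
    1, whence the factor 3. *)
Lemma exec_sort_rec ss s (T := (size s + sumn (shape ss))%N)
    (L := (trunc_log 2 T).+1) : graded 0 ss ->
  (exec (sort_rec ss s)).1 = sort_rec1 le_cost ss s /\
  ((exec (sort_rec ss s)).2 + 2 * weight 0 ss <=
    2 * size s + 3 * (L * T) + 2 * L + 1)%N.
Proof.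
rewrite {}/L {}/T; elim: s ss => [|x s IH] ss g /=.
  have : (size ss <= (trunc_log 2 (sumn (shape ss))).+1)%N.
    case: ss g => // s ss g; have := graded_size g isT.
    by rewrite add0n /= => H; rewrite ltnS trunc_log_max.
  have [p1 p2] := exec_sort_pop [::] ss; rewrite p1.
  move: p2 (weight_le 0 ss); rewrite /= !add0n => p2 w H; split=> //.
  move: p2 w H.
  move: (trunc_log _ _) => b; move: (size ss) (sumn _) (weight _ _) => a c w; nia.
have [p1 p2] := @exec_sort_push 0 [:: x] ss isT.
have [g' _ sh] := @graded_push 0 [:: x] ss isT g.
rewrite exec_bind /= p1; have [r1 r2] := IH _ g'; rewrite r1; split=> //.
move: r2 p2; rewrite sh /= addnCA add1n -addSnnS => r2 p2.
by move: r2 p2; move: (trunc_log _ _); lia.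
Qed.

Lemma exec_sort s (L := (trunc_log 2 (size s)).+1) :
  (exec (sort_rec [::] s)).1 = sort le_cost s /\
  ((exec (sort_rec [::] s)).2 <= 2 * size s + 3 * (L * size s) + 2 * L + 1)%N.
Proof. by have := @exec_sort_rec [::] s isT; rewrite /= !addn0 sortE. Qed.

Lemma exec_size_succ s :
  exec (size_succ s) = ((size s).+1%:R, (2 * size s).+1).
Proof.
elim: s => [|x s IH] //=; rewrite exec_bind IH /pay /= natr1.
by rewrite mulnS addn2.
Qed.

Lemma time_consider N A B Bt l : ((exec (consider I N A B Bt l)).2 <= 14)%N.
Proof. by rewrite /consider /=; case: ifP. Qed.

Lemma time_better (p q : option (candidate R)) : ((exec (better I p q)).2 <= 1)%N.
Proof. by case: p q => [a|] [b|] //=; case: ifP. Qed.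

Lemma time_stationary N A B Bt : ((exec (stationary I N A B Bt)).2 <= 36)%N.
Proof. by rewrite /stationary /=; case: (_ <= _). Qed.

(** 84 = 3 * 14 + 36 + 2 + 4: three calls of [consider], one of [stationary], two of [better], and
    four other instructions. *)
Lemma time_solve_bracket N A B Bt lo hi :
  ((exec (solve_bracket I N A B Bt lo hi)).2 <= 84)%N.
Proof.
rewrite /solve_bracket.
have := time_stationary N A B Bt; have := time_consider N A B Bt.
move: (stationary I N A B Bt) (consider I N A B Bt) => st co time_co time_st.
rewrite !exec_bind /=; case: ifP => //= _; rewrite !exec_bind /=.
set e1 := exec (co lo); have t1 : (e1.2 <= 14)%N by exact: time_co.
set e2 := exec (if hi is Some r then co r else Ret None).
have t2 : (e2.2 <= 14)%N by rewrite /e2; case: (hi).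
have := time_better e1.1 e2.1; move: (exec (better I e1.1 e2.1)) => [c12 tb] /= tb1.
case: (exec st) time_st => -[l|] ts /= tst; last by lia.
rewrite exec_bind /=.
set e3 := exec (if hi is Some r then leqK I l r else Ret true).
have t3 : (e3.2 <= 1)%N by rewrite /e3; case: (hi).
case: (_ && _) => /=; last by lia.
rewrite exec_bind /=; have := time_better c12 (exec (co l)).1; have := time_co l.
lia.
Qed.

Lemma time_scan_step N M (st : scan_state R) x hi :
  ((exec (scan_step I N M st x hi)).2 <= 93)%N.
Proof.
rewrite /scan_step; have := time_solve_bracket N.
move: (@solve_bracket I R) => sb time_sb /=; rewrite !exec_bind /=.
set e := exec (sb _ _ _ _ _ _); have te : (e.2 <= 84)%N by exact: time_sb.
have : ((exec (update_best I (idx st).+1 (best st) e.1)).2 <= 1)%N.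
  by case: (best st) e.1 => [[c k]|] [d|] //=; case: ifP.
lia.
Qed.

Lemma time_scan N M (st : scan_state R) s :
  ((exec (scan N M st s)).2 <= 93 * size s + 1)%N.
Proof.
elim: s st => [|[i x] s IH] st //.
rewrite -[scan N M st _]/(bind (scan_step I N M st x (omap snd (ohead s)))
  (fun st' => scan N M st' s)) exec_bind2.
have := time_scan_step N M st x (omap snd (ohead s)).
by move: (exec (scan_step _ _ _ _ _ _)) => e te; have := IH e.1; rewrite /=; lia.
Qed.

Lemma exec_levels lam den zero k s (d : user) :
  (size (exec (levels lam den zero k s)).1 = size s /\
  forall j, (j < size s)%N -> nth d (exec (levels lam den zero k s)).1 j =
    ((nth d s j).1, if (j < k)%N then (lam - (nth d s j).2) / den else zero)) /\
  ((exec (levels lam den zero k s)).2 <= 2 * size s + 1)%N.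
Proof.
elim: s k => [|[i x] s IH] k //=.
case: k => [|k] /=; rewrite exec_bind /=.
  have [[-> nth_s] ts] := IH 0%N; split; last by lia.
  by split=> // -[|j] //= /nth_s ->; rewrite !ltn0.
have [[-> nth_s] ts] := IH k; split; last by lia.
by split=> // -[|j] //= /nth_s ->.
Qed.

Lemma exec_algorithm1 V s
  (srt := sort le_cost [seq (x.1, virtual_cost (F x.1) (f x.1) x.2) | x <- s])
  (M := 2 * ((size s).+1%:R * V))
  (st := (exec (scan (size s).+1%:R M (ScanState 0 0 0 0 None) srt)).1) :
  (exec (algorithm1 V s)).1 =
  if best st is Some (c, k) then
    Some (exec (levels (cand_point c) (M * (cand_slope c * cand_slope c)) 0 k srt)).1
  else None.
Proof.
rewrite /algorithm1 exec_bind1 exec_virtual_costs exec_bind1 (exec_sort _).1 -/srt.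
have sz : size srt = size s by rewrite size_sort size_map.
rewrite exec_bind1 exec_size_succ sz.
rewrite {}/st; move: (@scan I R) (@levels I R) => sc lv /=.
rewrite exec_bind1 -/M; case: (best _) => [[c k]|] //=.
by rewrite exec_bind1.
Qed.

Lemma time_algorithm1 V s (l := trunc_log 2 (size s)) : (1 < size s)%N ->
  ((exec (algorithm1 V s)).2 <= 150 * (size s * l))%N.
Proof.
move=> s1.
(* The bounds add up to 106 n + 3 n l + 2 l + 13, with n = [size s]. As l >= 1 and n >= 2, all of
   this is absorbed into n l, and 150 leaves some room. *)
have l1 : (0 < l)%N by rewrite /l trunc_log_gt0 /=; lia.
rewrite /algorithm1 exec_bind2 exec_virtual_costs /= exec_bind2.
set vs := map _ s; have sz : size vs = size s by rewrite size_map.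
have [-> tsort] := exec_sort vs; rewrite sz -/l in tsort.
set srt := sort _ _; have sz' : size srt = size s by rewrite size_sort.
rewrite exec_bind2 exec_size_succ sz'.
have tsc N M st := time_scan N M st srt.
have tlv lam den z k : ((exec (levels lam den z k srt)).2 <= 2 * size srt + 1)%N.
  case: (srt) => [|x r] //.
  by have [] := exec_levels lam den z k (x :: r) x.
move: (@scan I R) (@levels I R) tsc tlv => sc lv tsc tlv /=.
rewrite exec_bind2 /=; set e := exec (sc _ _ _ _).
have te : (e.2 <= 93 * size srt + 1)%N by exact: tsc.
rewrite sz' in te tlv.
move: tsort; move: (exec (sort_rec [::] vs)).2 => a tsort.
case: (best e.1) => [[c k]|] /=; last by nia.
rewrite exec_bind2 /= addn0; set e2 := exec (lv _ _ _ _ _).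
have : (e2.2 <= 2 * size s + 1)%N by exact: tlv.
move: (e.2) (e2.2) te => b b2; nia.
Qed.

End Run.

(** * Optimality of the algorithm *)

Section Optimality.
Context (R : realType) (n : nat) (V : R) (psi : 'I_n -> R) (s : 'S_n).
Hypotheses (n0 : (0 < n)%N) (V0 : 0 < V) (psi0 : forall i, 0 <= psi i).
Hypothesis s_mono : forall j k : 'I_n, (j <= k)%N -> psi (s j) <= psi (s k).

Local Notation t := (sorted_costs psi s).
Local Notation A := (Defs.coefA n V).
Local Notation B := (Defs.coefB n V t).
Local Notation slope i l := (l * A i - B i).
Local Notation OBJ := (OBJ n V t).
Local Notation bracket := (bracket n t).

Lemma sorted_costsE (j : 'I_n) : t j.+1 = psi (s j).
Proof.
by rewrite /sorted_costs (nth_map j) ?size_enum_ord //= nth_ord_enum.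
Qed.

Lemma sorted_costs_mono j k : (1 <= j <= k)%N -> (k <= n)%N -> t j <= t k.
Proof.
case: j => // j; case: k => // k /= jk kn.
by rewrite (sorted_costsE (Ordinal (leq_trans jk kn))) (sorted_costsE (Ordinal kn)) s_mono.
Qed.

Lemma sorted_costs_in k : (1 <= k <= n)%N -> exists j, t k = psi j.
Proof.
by case: k => // k /= kn; exists (s (Ordinal kn)); rewrite -sorted_costsE.
Qed.

Definition alg_levels i l (j : 'I_n) : R := level n V t i l ((s^-1)%g j).

Lemma acquisition_cost_perm y :
  acquisition_cost V (fun j : 'I_n => t j.+1) (fun j => y (s j)) =
  acquisition_cost V psi y.
Proof.
have E (h : 'I_n -> R) : \sum_j h (s j) = \sum_j h j.
  by rewrite [RHS](reindex_perm s).
have Et : \sum_(j < n) t j.+1 * y (s j) = \sum_j psi (s j) * y (s j).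
  by apply: eq_bigr => j _; rewrite sorted_costsE.
rewrite /acquisition_cost Et (E y) (E (fun j => y j ^+ 2 * V)).
by rewrite (E (fun j => psi j * y j)).
Qed.

Lemma cost_alg_levels i l : (i <= n)%N -> slope i l != 0 ->
  acquisition_cost V psi (alg_levels i l) = OBJ i l.
Proof.
move=> le_in u0; rewrite -acquisition_cost_perm -cost_level //.
by congr acquisition_cost; apply/funext => j; rewrite /alg_levels permK.
Qed.

Lemma alg_levels_ge0 i l j : (1 <= i <= n)%N -> t i <= l -> 0 <= alg_levels i l j.
Proof.
move=> i1n til.
by rewrite /alg_levels (level_ge0 V0 sorted_costs_mono _ i1n til).
Qed.

Definition minimal i l : Prop :=
  forall k m, (1 <= k <= n)%N -> bracket k m -> (OBJ i l <= OBJ k m)%E.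

Lemma minimal_slope i l :
  (forall k m, (1 <= k <= n)%N -> bracket k m -> 0 < slope k m ->
    (OBJ i l <= OBJ k m)%E) -> minimal i l.
Proof.
move=> min k m k1n km; have u0 := slope_ge0 V0 sorted_costs_mono k1n km.1.
have [u_eq0|un] := eqVneq (slope k m) 0.
  by rewrite {2}/Defs.OBJ u_eq0 eqxx leey.
by apply: min => //; rewrite lt0r un.
Qed.

(** A point of positive slope in the unbounded bracket: it shows that [OBJ] takes a finite value, so
    that no minimum is +oo. *)
Lemma bracket_last : bracket n (t n + 1).
Proof. by split; rewrite ?ltnn // lerDl. Qed.

Lemma slope_last : 0 < slope n (t n + 1).
Proof.
have -> : slope n (t n + 1) = slope n (t n) + A n by ring.
have A0 := coefA_gt0 n V0 n0.
by rewrite ltr_wpDl // (slope_ge0 V0 sorted_costs_mono) // n0 leqnn.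
Qed.

Lemma minimal_slope_gt0 i l : (1 <= i <= n)%N -> bracket i l -> minimal i l ->
  0 < slope i l.
Proof.
move=> i1n il min; have u0 := slope_ge0 V0 sorted_costs_mono i1n il.1.
rewrite lt0r u0 andbT; apply/eqP => u_eq0.
have := min n _ _ bracket_last; rewrite n0 leqnn => /(_ isT).
by rewrite /Defs.OBJ u_eq0 eqxx (gt_eqF slope_last) leye_eq.
Qed.

Lemma minimal_optimal i l : (1 <= i <= n)%N -> bracket i l -> minimal i l ->
  optimal_levels V psi (alg_levels i l).
Proof.
move=> i1n il min; have u0 := minimal_slope_gt0 i1n il min.
have /andP[_ le_in] := i1n.
split=> [j|z z0]; first exact: alg_levels_ge0 il.1.
rewrite cost_alg_levels ?lt0r_neq0 // -(acquisition_cost_perm z).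
have [Sz|Sz] := eqVneq (\sum_j z (s j)) 0.
  by rewrite /acquisition_cost Sz eqxx leey.
have [k [m [k1n km uk]]] := exists_OBJ_le V0 sorted_costs_mono n0
  (fun j => z0 (s j)) Sz.
by apply: le_trans; exact: min.
Qed.

(** Some pair does at least as well as z by water filling. No pair does better, since the levels
    attached to a pair of positive slope are feasible and cost exactly its [OBJ]. *)
Lemma optimal_minimal z : optimal_levels V psi z ->
  exists i l, [/\ (1 <= i <= n)%N, bracket i l & minimal i l].
Proof.
move=> [z0 zmin].
have le_OBJ k m : (1 <= k <= n)%N -> bracket k m -> 0 < slope k m ->
    (acquisition_cost V psi z <= OBJ k m)%E.
  move=> k1n km u0; have /andP[_ kn] := k1n.
  rewrite -cost_alg_levels ?lt0r_neq0 //; apply: zmin => j.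
  exact: alg_levels_ge0 km.1.
have Sz : \sum_j z (s j) != 0.
  apply/eqP => Sz.
  have := le_OBJ _ _ _ bracket_last slope_last; rewrite n0 leqnn => /(_ isT).
  rewrite -acquisition_cost_perm /acquisition_cost Sz eqxx.
  by rewrite /Defs.OBJ (gt_eqF slope_last).
have [i [l [i1n il _ le_z]]] := exists_OBJ_le V0 sorted_costs_mono n0
  (fun j => z0 (s j)) Sz.
exists i, l; split=> //; apply: minimal_slope => k m k1n km uk.
apply: le_trans le_z _; rewrite acquisition_cost_perm; exact: le_OBJ.
Qed.

(* When t_1 = ... = t_i = 0, halving lambda decreases OBJ. *)
Lemma minimal_coefB_gt0 i l : (1 <= i <= n)%N -> bracket i l -> minimal i l ->
  0 < B i.
Proof.
move=> i1n il min; have u0 := minimal_slope_gt0 i1n il min.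
have M0 := coefM_gt0 n V0; have /andP[i1 le_in] := i1n.
have A0 := coefA_gt0 n V0 i1.
have t0 (j : 'I_i) : 0 <= t j.+1.
  have [k ->] : exists k, t j.+1 = psi k.
    by apply: sorted_costs_in => /=; exact: leq_trans (ltn_ord j) le_in.
  exact: psi0.
rewrite lt0r coefBE; apply/andP; split; last first.
  by rewrite divr_ge0 ?sumr_ge0 // ltW.
rewrite mulf_eq0 invr_eq0 (gt_eqF M0) orbF; apply/eqP => St.
have tE (j : 'I_i) : t j.+1 = 0.
  exact: (psumr_eq0P (P := xpredT) (F := fun j : 'I_i => t j.+1)).
have ti : t i = 0.
  by case: i i1 tE {i1n il min u0 le_in A0 t0 St} => // i _ tE; exact: tE ord_max.
have BE : B i = 0 by rewrite coefBE St mul0r.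
have BtE : coefBt n V t i = 0.
  by rewrite coefBtE big1 ?mul0r // => j _; rewrite tE expr0n.
rewrite BE subr0 in u0.
have l0 : 0 < l by rewrite -(pmulr_lgt0 _ A0).
have il2 : bracket i (l / 2).
  case: il => _ il; split; first by rewrite ti divr_ge0 // ltW.
  by move=> /il; apply: le_trans; rewrite ler_pdivrMr // mulr_natr mulr2n lerDl ltW.
have := min _ _ i1n il2; rewrite /Defs.OBJ BE BtE !subr0.
have u2 : 0 < l / 2 * A i by rewrite mulr_gt0 // divr_gt0.
rewrite (gt_eqF u0) (gt_eqF u2) lee_fin leNgt => /negP; apply.
(* With B and Bt equal to 0 the fraction does not depend on l, and only the term in the squared
   slope shrinks. *)
have -> : A i * (l / 2) ^+ 2 / (2 * (l / 2 * A i) ^+ 2) =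
          A i * l ^+ 2 / (2 * (l * A i) ^+ 2).
  by field; rewrite !lt0r_neq0.
rewrite ltrD2r ltr_pM2l ?mulr_gt0 ?ltr0n //.
rewrite ltr_pXn2r ?nnegrE ?ltW //.
by rewrite ltr_pM2r // ltr_pdivrMr // mulr_natr mulr2n ltrDl.
Qed.

Lemma minimal_is_lambda i l : (1 <= i <= n)%N -> bracket i l -> minimal i l ->
  is_lambda n V t i l.
Proof. by move=> i1n il min; split=> // m; exact: min. Qed.

End Optimality.

(** * Link between the specification of the algorithm and the program *)

Section Algorithm.
Context (R : realType) (n : nat) (V : R) (psi : 'I_n -> R).
Hypotheses (n0 : (0 < n)%N) (V0 : 0 < V).

(** Solvability yields a joint minimum at some index k, so [OBJ] has a minimiser on the bracket of k
    and k competes for [istar], which does at least as well. *)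
Lemma algorithm1_returns_optimal (y z : 'I_n -> R) : optimal_levels V psi z ->
  algorithm1_returns V psi y -> optimal_levels V psi y.
Proof.
move=> opt_z [s [lam [istar []]]]; set t := sorted_costs psi s.
move=> s_mono lamP [[i1n [istarP _]] istar_min] yE.
have [k [m [k1n km min]]] := optimal_minimal n0 V0 s_mono opt_z.
have is_lam := minimal_is_lambda k1n km min.
have [k_in k_min] := lamP k k1n (ex_intro _ _ is_lam).
have -> : y = alg_levels V psi s istar (lam istar).
  by apply/funext => j; rewrite /alg_levels -{1}(permKV s j) yE.
apply: minimal_optimal => // a b a1n ab.
apply: le_trans (min _ _ a1n ab).
apply: le_trans (k_min _ km).
exact: istar_min.
Qed.

Lemma alg_levels_returned (s : 'S_n) k l :
  (forall i j : 'I_n, (i <= j)%N -> psi (s i) <= psi (s j)) ->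
  (1 <= k <= n)%N -> bracket n (sorted_costs psi s) k l -> minimal V psi s k l ->
  algorithm1_returns V psi (alg_levels V psi s k l).
Proof.
move=> s_mono k1n kl min; set t := sorted_costs psi s.
(* The default 0 is harmless: it occurs only at indices without a minimiser, and these do not
   compete. *)
pose lam i := if i == k then l else
  if pselect (exists m, is_lambda n V t i m) is left e then projT1 (cid e) else 0.
have lamk : lam k = l by rewrite /lam eqxx.
exists s, lam, k; split=> //.
- move=> i i1n ex; rewrite /lam; case: eqP => [->|_].
    exact: minimal_is_lambda.
  by case: pselect => // e; exact: projT2 (cid e).
- split=> [|i [i1n [ibr _]]]; first by split=> //; rewrite lamk; exact: minimal_is_lambda.
  by rewrite lamk; exact: min.
- by move=> j; rewrite lamk /alg_levels permK.
Qed.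

Context (F f : 'I_n -> R -> R) (c : 'I_n -> R).
Hypothesis psiE : psi =1 fun i => virtual_cost (F i) (f i) (c i).

Lemma sorted_reports :
  exists s : 'S_n, (forall i j : 'I_n, (i <= j)%N -> psi (s i) <= psi (s j)) /\
  sort (@le_cost R 'I_n) [seq (x.1, virtual_cost (F x.1) (f x.1) x.2) | x <- reports c]
  = [seq (s j, psi (s j)) | j <- enum 'I_n].
Proof.
set v := map _ _.
have vE : v = [tuple (i, psi i) | i < n].
  by rewrite /v /reports -map_comp /=; apply: eq_map => i /=; rewrite psiE.
have : perm_eq (sort (@le_cost R 'I_n) v) [tuple (i, psi i) | i < n].
  by rewrite -vE perm_sort.
move=> /tuple_permP[s sE]; exists s.
have {}sE : sort (@le_cost R 'I_n) v = [seq (s j, psi (s j)) | j <- enum 'I_n].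
  by rewrite sE /=; apply: eq_map => j; rewrite tnth_mktuple.
split=> // i j ij.
have tot : total (@le_cost R 'I_n) by move=> x y; exact: le_total.
have tr : transitive (@le_cost R 'I_n) by move=> x y z; exact: le_trans.
have refl : reflexive (@le_cost R 'I_n) by move=> x; exact: lexx.
have srt := sort_sorted tot v; rewrite sE in srt.
have sz (k : 'I_n) :
    (k : nat) \in [pred m | (m < size [seq (s j, psi (s j)) | j <- enum 'I_n])%N].
  by rewrite inE size_map size_enum_ord.
have := sorted_leq_nth tr refl (i, psi i) srt i j (sz i) (sz j) ij.
have nthE (k : 'I_n) :
    nth (i, psi i) [seq (s j, psi (s j)) | j <- enum 'I_n] k = (s k, psi (s k)).
  by rewrite (nth_map i) ?size_enum_ord // nth_ord_enum.
by rewrite !nthE.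
Qed.

(** The given pair i, l guarantees that the scan finds a candidate. It will be a point of the last
    bracket when all reports are positive, and a minimal pair when the problem is known to be
    solvable. *)
Lemma exec_algorithm1_reports :
  exists s : 'S_n, (forall i j : 'I_n, (i <= j)%N -> psi (s i) <= psi (s j)) /\
  forall i l, (1 <= i <= n)%N -> bracket n (sorted_costs psi s) i l ->
    0 < l * Defs.coefA n V i - Defs.coefB n V (sorted_costs psi s) i ->
    0 < Defs.coefB n V (sorted_costs psi s) i ->
  exists k m, [/\ (1 <= k <= n)%N, bracket n (sorted_costs psi s) k m,
    (forall a b, (1 <= a <= n)%N -> bracket n (sorted_costs psi s) a b ->
      0 < b * Defs.coefA n V a - Defs.coefB n V (sorted_costs psi s) a ->
      0 < Defs.coefB n V (sorted_costs psi s) a ->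
      (OBJ n V (sorted_costs psi s) k m <= OBJ n V (sorted_costs psi s) a b)%E)
    & (exec F f (algorithm1 V (reports c))).1 =
      Some [seq (s j, alg_levels V psi s k m (s j)) | j <- enum 'I_n]].
Proof.
have [s [s_mono srtE]] := sorted_reports.
exists s; split=> // i l i1n il ul Bi.
rewrite exec_algorithm1 srtE.
have -> : size (reports c) = n by rewrite size_map size_enum_ord.
set srt := map _ _; set st := (exec _ _ _).1.
have sz : size srt = n by rewrite size_map size_enum_ord.
set t := sorted_costs psi s in il ul Bi *.
have MV : 2 * (n.+1%:R * V) = Defs.coefM n V by rewrite /Defs.coefM mulrA.
have [] : scan_inv n V t n st.
  rewrite /st MV; apply: (@scan_inv_scan _ _ _ _ n V t V0 _ srt 0) => //.
    exact: sorted_costs_mono.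
    by move=> j _; rewrite add0n /t /sorted_costs /unzip2 -map_comp.
  by split=> //; split=> // a b; case: a.
move=> _ _ _ _ [gd cv]; have := cv i l i1n il ul Bi.
case: (best st) gd cv => [[k0 k]|] //= [k1n km u0 uE kE] cv _.
exists k, (cand_point k0); split=> //.
  by move=> a b a1n ab ub Ba; rewrite kE; exact: cv.
congr Some; rewrite MV uE -expr2.
set den := _ * _.
pose d := (s (Ordinal n0), 0 : R).
have [[sz_out nth_out] _] := exec_levels F f (cand_point k0) den 0 k srt d.
apply: (@eq_from_nth _ d); first by rewrite sz_out sz size_map size_enum_ord.
rewrite sz_out => j js; rewrite nth_out //.
have jn : (j < n)%N by rewrite -sz.
have nthE (h : 'I_n -> 'I_n * R) :
    nth d [seq h i | i <- enum 'I_n] j = h (Ordinal jn).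
  rewrite (nth_map (Ordinal n0)) ?size_enum_ord //; congr h.
  exact: nth_ord_enum (Ordinal n0) (Ordinal jn).
rewrite /srt !nthE /= /alg_levels permK /level -/t /=.
by rewrite -(sorted_costsE psi s (Ordinal jn)).
Qed.

End Algorithm.

Lemma trunc_log2_le_ln (R : realType) n : (0 < n)%N ->
  (trunc_log 2 n)%:R * ln 2 <= ln n%:R :> R.
Proof.
move=> n0; rewrite mulr_natl -lnXn // ler_ln ?posrE ?exprn_gt0 ?ltr0n //.
by rewrite -natrX ler_nat trunc_logP.
Qed.

Unset Implicit Arguments.

Theorem proposition3 (R : realType) :
  exists C : R, forall (n : nat) (V : R)
    (d : measure_display) (T : measurableType d) (P : probability T R)
    (X : 'I_n -> {RV P >-> R}) (f : 'I_n -> R -> R) (c : 'I_n -> R),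
  (0 < n)%N -> 0 < V ->
  (forall i w, 0 <= X i w) ->
  (forall i, is_density (X i) (f i)) ->
  (forall i, 0 <= c i) ->
  (forall i, 0 < f i (c i)) ->
  let F := fun i x => fine (cdf (X i) x) in
  let psi := fun i => virtual_cost (F i) (f i) (c i) in
  let solvable := exists z, optimal_levels V psi z in
  let run := exec F f (algorithm1 V (reports c)) in
  [/\ ((forall i, 0 < c i) -> solvable),
      (solvable -> forall y, algorithm1_returns V psi y ->
         optimal_levels V psi y),
      (solvable -> exists (y : 'I_n -> R) (out : seq ('I_n * R)),
         [/\ run.1 = Some out, perm_eq out [seq (i, y i) | i <- enum 'I_n],
             algorithm1_returns V psi y & optimal_levels V psi y])
    & ((1 < n)%N -> run.2%:R <= C * (n%:R * ln n%:R))].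
Proof.
exists (150 / ln 2) => n V d T P X f c n0 V0 X0 fX c0 fc0 F psi solvable run.
have F0 i : 0 <= F i (c i) by rewrite fine_ge0 // cdf_ge0.
have psi_c i : c i <= psi i by rewrite lerDl divr_ge0 // ltW.
have psi0 i : 0 <= psi i by exact: le_trans (psi_c i).
have [s [s_mono prog]] := exec_algorithm1_reports n0 V0 (psi := psi)
  (F := F) (f := f) (c := c) (fun=> erefl).
split.
(* Positive reports make every virtual cost positive, so no index is skipped and the pair chosen by
   the program is a joint minimum. *)
- move=> c1; have B0 i : (1 <= i <= n)%N ->
      0 < Defs.coefB n V (sorted_costs psi s) i.
    move=> /andP[i1 le_in].
    have t0 j : (j < n)%N -> 0 < sorted_costs psi s j.+1.
      move=> jn; have [k ->] := @sorted_costs_in _ _ psi s j.+1 jn.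
      exact: lt_le_trans (psi_c k).
    rewrite coefBE divr_gt0 ?coefM_gt0 //.
    case: i i1 le_in => // i _ lt_in; rewrite big_ord_recr /= ltr_wpDl ?t0 //.
    by apply: sumr_ge0 => j _; rewrite ltW // t0 // (ltn_trans (ltn_ord j)).
  have nn : (1 <= n <= n)%N by rewrite n0 leqnn.
  have [k [m [k1n km min _]]] := prog _ _ nn (bracket_last psi s)
    (slope_last n0 V0 s_mono) (B0 _ nn).
  exists (alg_levels V psi s k m); apply: minimal_optimal => //.
  apply: minimal_slope => // a b a1n ab ub; apply: min => //; exact: B0.
- by move=> [z opt_z] y; exact: algorithm1_returns_optimal opt_z.
- move=> [z opt_z]; have [i [l [i1n il min]]] := optimal_minimal n0 V0 s_mono opt_z.
  have ul := minimal_slope_gt0 n0 V0 s_mono i1n il min.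
  (* Reports may be 0 here, so some indices may be skipped, but not that of the minimum; hence the
     program's pair, no worse than this one, is minimal too. *)
  have Bi := minimal_coefB_gt0 n0 V0 psi0 s_mono i1n il min.
  have [k [m [k1n km le_i runE]]] := prog _ _ i1n il ul Bi.
  have min_k : minimal V psi s k m.
    by move=> a b a1n ab; apply: le_trans (min _ _ a1n ab); exact: le_i.
  exists (alg_levels V psi s k m).
  exists [seq (s j, alg_levels V psi s k m (s j)) | j <- enum 'I_n]; split=> //.
  + rewrite (map_comp (fun j => (j, alg_levels V psi s k m j)) s); apply: perm_map.
    apply: uniq_perm; rewrite ?(map_inj_uniq perm_inj) ?enum_uniq //.
    move=> j; rewrite mem_enum; apply/mapP; exists ((s^-1)%g j).
      by rewrite mem_enum.
    by rewrite permKV.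
  + exact: alg_levels_returned.
  + exact: minimal_optimal.
move=> n1; have ln2 : 0 < ln 2 :> R by rewrite ln_gt0 // ltr1n.
have sz : size (reports c) = n by rewrite size_map size_enum_ord.
have := @time_algorithm1 R _ F f V (reports c); rewrite sz => /(_ n1) le_t.
apply: (@le_trans _ _ (150 * (n * trunc_log 2 n))%:R); first by rewrite ler_nat.
rewrite !natrM -mulrA ler_pM2l ?ltr0n // mulrCA ler_pM2l ?ltr0n //.
by rewrite mulrC ler_pdivlMr // trunc_log2_le_ln.
Qed.
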